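(* Let $n\ge 3$ be an integer and let $a=(a_1,\ldots,a_{n+1})\in\mathbb{C}^{n+1}$. For each $(j,k)\in\mathcal{I}_n$ and each $i_0\in\{0,1,\ldots,n\}\setminus\{j,k\}$, the map $$\varphi_{kj}^{(i_0)}:\mathcal{S}_{kj}^{(i_0)}(a)\to\mathcal{M}_{kj}^{(i_0)}(a)$$ (which sends $x$ to the conjugacy class of its $(k,j;i_0)$-normal form) is bijective. These bijections are patched together (they agree on overlaps) to yield a global bijection between the big opens $$\varphi:\mathcal{S}^\circ(a)\to\mathcal{M}^\circ(a),$$ that is, a bijection whose restriction to each $\mathcal{S}_{kj}^{(i_0)}(a)$ is $\varphi_{kj}^{(i_0)}$.
   Context: **Moduli space.** Fix $n\ge3$ and $a=(a_1,\dots,a_{n+1})\in\mathbb{C}^{n+1}$ (the condition $a_j\neq\pm2$ is not required). $\mathcal{O}(a_j)=\{M\in \mathrm{SL}(2,\mathbb{C}): \operatorname{tr}M=a_j\}$. For $M_1,\dots,M_n\in\mathrm{SL}(2,\mathbb{C})$ put $M_{n+1}:=(M_nM_{n-1}\cdots M_1)^{-1}$. $\mathcal{M}(a)$ is the set of tuples $(M_1,\dots,M_n)\in\mathcal{O}(a_1)\times\cdots\times\mathcal{O}(a_n)$ with $M_{n+1}\in\mathcal{O}(a_{n+1})$, modulo simultaneous conjugation by $\mathrm{SL}(2,\mathbb{C})$; $[\rho]=[(M_1,\dots,M_n)]$ denotes a class. $\mathcal{M}(a)^{irr}\subset\mathcal{M}(a)$ is the subset of irreducible classes (no common invariant subspace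 of $M_1,\dots,M_n$ other than $\{0\}$ and $\mathbb{C}^2$). **Trace coordinates.** For $[\rho]\in\mathcal{M}(a)^{irr}$ put $x_{ji}=\operatorname{tr}(M_jM_i)$, $x_{kji}=\operatorname{tr}(M_kM_jM_i)$ for distinct $i,j,k\in\{1,\dots,n\}$. Coordinates on $\mathbb{C}^m$: if $n=3$, $m=3$ and $x=(x_{21},x_{31},x_{32})$, with $x_{321}:=a_4$; if $n\ge4$, $m=\binom n3+\binom n2$ and $x$ consists of all $x_{ji}$ ($1\le i<j\le n$) and all $x_{kji}$ ($1\le i<j<k\le n$). For any $x\in\mathbb{C}^m$ the symbols with indices in other orders are defined by $x_{ij}=x_{ji}$, $x_{kji}=x_{jik}=x_{ikj}$ and $x_{kij}=a_kx_{ji}+a_jx_{ki}+a_ix_{kj}-a_ka_ja_i-x_{kji}$ (identities satisfied by the traces). **The affine algebraic set $\mathcal{S}(a)\subset\mathbb{C}^m$** is the common zero set of the following polynomials. Put $s_3(i_1,i_2,i_3)=a_{i_1}x_{i_3i_2}+a_{i_2}x_{i_3i_1}+a_{i_3}x_{i_2i_1}-a_{i_3}a_{i_2}a_{i_1}-2x_{i_3i_2i_1}$ for $i_1<i_2<i_3$, $z_{i,i}=\frac12a_i^2-2$, and $z_{i,j}=x_{ij}-\frac12a_ia_j$ for $i\ne j$. - Type 1 ($n\ge3$): $s_3(i_1,i_2,i_3)s_3(j_1,j_2,j_3)+2\det(z_{i_p,j_q})_{1\le p,q\le3}$ for all $1\le i_1<i_2<i_3\le n$, $1\le j_1<j_2<j_3\le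 n$. - Type 2 ($n\ge4$): $\sum_{k=0}^3(-1)^kz_{i,p_k}\,s_3(p_0,\dots,\widehat{p_k},\dots,p_3)$ for all $1\le i\le n$, $1\le p_0<p_1<p_2<p_3\le n$ (hat means omission). - Type 3 ($n\ge4$): $g_{n,n-1,\dots,1}(x)-a_{n+1}$, where $g_{i_1}=a_{i_1}$, $g_{i_2,i_1}=x_{i_2i_1}$, $g_{i_3,i_2,i_1}=x_{i_3i_2i_1}$ for increasing $i_1<i_2<\cdots$, and for $k\ge4$, $i_1<\cdots<i_k$, $$\begin{aligned}g_{i_k,\dots,i_1}=\tfrac12\{&g_{i_k,\dots,i_4}a_{i_3}a_{i_2}a_{i_1}+g_{i_k,\dots,i_4}x_{i_3i_2i_1}+\textstyle\sum_{p=1}^3a_{i_p}g_{i_k,\dots,\widehat{i_p},\dots,i_1}\\&+g_{i_k,\dots,i_3}x_{i_2i_1}-g_{i_k,\dots,i_4,i_2}x_{i_3i_1}+g_{i_k,\dots,i_4,i_1}x_{i_3i_2}\\&-g_{i_k,\dots,i_4}a_{i_3}x_{i_2i_1}-g_{i_k,\dots,i_4}a_{i_1}x_{i_3i_2}-g_{i_k,\dots,i_4,i_1}a_{i_3}a_{i_2}-g_{i_k,\dots,i_3}a_{i_2}a_{i_1}\}.\end{aligned}$$ Assigning to $[\rho]$ its trace coordinates gives a map $\Phi:\mathcal{M}(a)^{irr}\to\mathcal{S}(a)$. **Charts.** $\mathcal{I}_n$ is the set of $(j,k)\in\mathbb{N}^2$ with $1\le j\le n$ and: $2\le k<n$ if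 $j=1$; $j<k\le n$ if $2\le j<n$; $k=1$ if $j=n$. Let $\psi(s,t,u)=s^2+t^2+u^2-stu-4$. For $(j,k)\in\mathcal{I}_n$ put $p_{kj}^{(0)}(x)=(x_{kj}^2-4)\psi(x_{kj},a_k,a_j)$ and, for $i_0\in\{1,\dots,n\}\setminus\{j,k\}$, $p_{kj}^{(i_0)}(x)=(x_{kj}^2-4)\psi(x_{kji_0},x_{kj},a_{i_0})$. Set $\mathcal{S}_{kj}^{(i_0)}(a)=\{x\in\mathcal{S}(a):p_{kj}^{(i_0)}(x)\ne0\}$, $\mathcal{M}_{kj}^{(i_0)}(a)=\{[\rho]\in\mathcal{M}(a)^{irr}:p_{kj}^{(i_0)}(\Phi([\rho]))\neq0\}$. The big opens are $\mathcal{S}^\circ(a)=\bigcup\mathcal{S}_{kj}^{(i_0)}(a)$ and $\mathcal{M}^\circ(a)=\bigcup\mathcal{M}_{kj}^{(i_0)}(a)$, unions over $(j,k)\in\mathcal{I}_n$ and $i_0\in\{0,\dots,n\}\setminus\{j,k\}$. **Normal forms and $\varphi_{kj}^{(i_0)}$.** For $x\in\mathcal{S}_{kj}^{(i_0)}(a)$ fix a square root $r_{kj}=\sqrt{x_{kj}^2-4}$ and put $\lambda_{kj}^\pm=(x_{kj}\pm r_{kj})/2$. The $(k,j;i_0)$-normal form of $x$ is the following tuple $(M_1,\dots,M_n)$, with $M_s=\begin{pmatrix} u_{11}^{(s)} & u_{12}^{(s)} \\ u_{21}^{(s)} & u_{22}^{(s)} \end{pmatrix}$. In all cases $$u_{11}^{(j)}=-\tfrac{a_k-\lambda_{kj}^+a_j}{r_{kj}},\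 u_{22}^{(j)}=\tfrac{a_k-\lambda_{kj}^-a_j}{r_{kj}},\ u_{11}^{(k)}=-\tfrac{a_j-\lambda_{kj}^+a_k}{r_{kj}},\ u_{22}^{(k)}=\tfrac{a_j-\lambda_{kj}^-a_k}{r_{kj}},$$ $$u_{12}^{(k)}=-\lambda_{kj}^+u_{12}^{(j)},\quad u_{21}^{(k)}=-\lambda_{kj}^-u_{21}^{(j)},\quad u_{11}^{(i)}=\tfrac{x_{kji}-\lambda_{kj}^-a_i}{r_{kj}},\ u_{22}^{(i)}=-\tfrac{x_{kji}-\lambda_{kj}^+a_i}{r_{kj}}\ (i\ne j,k).$$ (i) If $i_0=0$: $u_{21}^{(j)}=1$, $u_{12}^{(j)}=-\psi(x_{kj},a_k,a_j)/r_{kj}^2$, and for $i\neq j,k$ $$u_{12}^{(i)}=\tfrac{x_{ki}-a_ku_{22}^{(i)}+\lambda_{kj}^+(x_{ji}-a_ju_{11}^{(i)})}{r_{kj}},\quad u_{21}^{(i)}=\tfrac{r_{kj}\{x_{ki}-a_ku_{11}^{(i)}+\lambda_{kj}^-(x_{ji}-a_ju_{22}^{(i)})\}}{\psi(x_{kj},a_k,a_j)}.$$ (ii) If $i_0\in\{1,\dots,n\}\setminus\{j,k\}$, write $\psi_0=\psi(x_{kji_0},x_{kj},a_{i_0})$: $u_{21}^{(i_0)}=1$, $u_{12}^{(i_0)}=-\psi_0/r_{kj}^2$, $$u_{12}^{(j)}=-\tfrac{x_{ki_0}-a_ku_{11}^{(i_0)}+\lambda_{kj}^-(x_{ji_0}-a_ju_{22}^{(i_0)})}{r_{kj}},\quad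 u_{21}^{(j)}=-\tfrac{r_{kj}\{x_{ki_0}-a_ku_{22}^{(i_0)}+\lambda_{kj}^+(x_{ji_0}-a_ju_{11}^{(i_0)})\}}{\psi_0},$$ and for $i\ne j,k,i_0$ $$u_{12}^{(i)}=-\tfrac{\lambda_{kj}^-x_{ii_0}+r_{kj}u_{11}^{(i)}u_{11}^{(i_0)}-x_{kjii_0}}{r_{kj}},\quad u_{21}^{(i)}=-\tfrac{r_{kj}(\lambda_{kj}^+x_{ii_0}-r_{kj}u_{22}^{(i)}u_{22}^{(i_0)}-x_{kjii_0})}{\psi_0},$$ where $x_{kjii_0}=\frac12(a_ka_ja_ia_{i_0}+a_kx_{jii_0}+a_jx_{kii_0}+a_ix_{kji_0}+a_{i_0}x_{kji}+x_{kj}x_{ii_0}-x_{ki}x_{ji_0}+x_{ki_0}x_{ji}-a_ka_jx_{ii_0}-a_ka_{i_0}x_{ji}-a_ja_ix_{ki_0}-a_{i_0}a_ix_{kj})$. The map $\varphi_{kj}^{(i_0)}:\mathcal{S}_{kj}^{(i_0)}(a)\to\mathcal{M}_{kj}^{(i_0)}(a)$ sends $x$ to the class $[(M_1,\dots,M_n)]$ of its normal form; this class does not depend on the choice of square root. *)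

(* Defs.v *)
From HB Require Import structures.
From mathcomp Require Import all_boot all_order all_algebra.
From mathcomp Require Import complex.
From mathcomp Require Import boolp classical_sets functions reals.

Set Implicit Arguments.
Unset Strict Implicit.
Unset Printing Implicit Defensive.

Import Order.TTheory GRing.Theory Num.Theory.
Local Open Scope ring_scope.
Local Open Scope complex_scope.
Local Open Scope classical_set_scope.

(* The indices 1, ..., n are the elements of 'I_n, shifted by one.  So for
   a : n.+1.-tuple R[i] the entry a`_i with i : 'I_n is the parameter attached
   to the matrix M i, and the last entry a`_n is the parameter of M_(n+1). *)

(* A coordinate is labelled by its unordered set of indices: a pair, or, when
   n >= 4, a triple.  The entry at {i < j} is x_ji, and the entry at
   {i < j < k} is x_kji (indices in decreasing order). *)
Definition is_coord (n : nat) (A : {set 'I_n}) : bool :=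
  (#|A| == 2)%N || (4 <= n)%N && (#|A| == 3)%N.

Definition trpoint (R : realType) (n : nat) : Type :=
  {ffun {A : {set 'I_n} | is_coord A} -> R[i]}.

Lemma card_coord3 : #|{: {A : {set 'I_3} | is_coord A}}| = 3%N.
Proof.
rewrite card_sig -[RHS]/('C(3, 2)) -[X in 'C(X, 2)](card_ord 3) -card_draws.
by rewrite cardsE; apply: eq_card => A; rewrite !inE /is_coord /= orbF.
Qed.

Lemma card_coord n : (4 <= n)%N ->
  #|{: {A : {set 'I_n} | is_coord A}}| = ('C(n, 3) + 'C(n, 2))%N.
Proof.
move=> n4; rewrite card_sig -[n in 'C(n, 3)]card_ord -[n in 'C(n, 2)]card_ord.
rewrite -!card_draws -cardsUI.
have -> : [set A : {set 'I_n} | #|A| == 3%N]%SET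
            :&: [set A : {set 'I_n} | #|A| == 2%N]%SET = finset.set0.
  by apply/setP => A; rewrite !inE; case: eqP => // ->.
by rewrite cards0 addn0; apply: eq_card => A; rewrite !inE /is_coord n4 orbC.
Qed.

Section TraceCoordinates.
Variables (R : realType) (n : nat) (a : n.+1.-tuple R[i]).
Implicit Types (x : trpoint R n) (i j k : 'I_n).

(* The default value 0 is only reached for A that does not label a
   coordinate. *)
Definition trcoord x (A : {set 'I_n}) : R[i] := oapp x 0 (insub A).

Definition x2 x j i : R[i] := trcoord x [set j; i]%SET.

Definition x3base x k j i : R[i] :=
  if (n == 3)%N then a`_n else trcoord x [set k; j; i]%SET.

(* x3 x k j i is x_kji for distinct k, j, i in any order: the word k j i is a
   cyclic rotation either of the decreasing word or of the increasing one. *)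
Definition x3 x k j i : R[i] :=
  if [|| (i < j < k)%N, (k < i < j)%N | (j < k < i)%N] then x3base x k j i
  else a`_k * x2 x j i + a`_j * x2 x k i + a`_i * x2 x k j
       - a`_k * a`_j * a`_i - x3base x k j i.

Definition s3 x (i1 i2 i3 : 'I_n) : R[i] :=
  a`_i1 * x2 x i3 i2 + a`_i2 * x2 x i3 i1 + a`_i3 * x2 x i2 i1
  - a`_i3 * a`_i2 * a`_i1 - 2 * x3 x i3 i2 i1.

Definition zz x i j : R[i] :=
  if i == j then a`_i ^+ 2 / 2 - 2 else x2 x i j - a`_i * a`_j / 2.

Definition type1 x (i1 i2 i3 j1 j2 j3 : 'I_n) : R[i] :=
  s3 x i1 i2 i3 * s3 x j1 j2 j3
  + 2 * \det (\matrix_(p < 3, q < 3)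
                zz x (tnth [tuple i1; i2; i3] p) (tnth [tuple j1; j2; j3] q)).

Definition type2 x (i p0 p1 p2 p3 : 'I_n) : R[i] :=
  zz x i p0 * s3 x p1 p2 p3 - zz x i p1 * s3 x p0 p2 p3
  + zz x i p2 * s3 x p0 p1 p3 - zz x i p3 * s3 x p0 p1 p2.

(* The list of indices is given in increasing order: gword x [:: i1; ...; ik]
   is g_(ik, ..., i1).  The first argument of grec only bounds the recursion
   depth, see gword4. *)
Fixpoint grec x (m : nat) (s : seq 'I_n) {struct m} : R[i] :=
  if m isn't m'.+1 then 0 else
  let g := grec x m' in
  match s with
  | [::] => 0
  | [:: i1] => a`_i1
  | [:: i1; i2] => x2 x i2 i1
  | [:: i1; i2; i3] => x3 x i3 i2 i1
  | [:: i1, i2, i3 & s'] =>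
      (g s' * a`_i3 * a`_i2 * a`_i1 + g s' * x3 x i3 i2 i1
       + (a`_i1 * g [:: i2, i3 & s'] + a`_i2 * g [:: i1, i3 & s']
          + a`_i3 * g [:: i1, i2 & s'])
       + g (i3 :: s') * x2 x i2 i1 - g (i2 :: s') * x2 x i3 i1
       + g (i1 :: s') * x2 x i3 i2
       - g s' * a`_i3 * x2 x i2 i1 - g s' * a`_i1 * x2 x i3 i2
       - g (i1 :: s') * a`_i3 * a`_i2 - g (i3 :: s') * a`_i2 * a`_i1) / 2
  end.

Definition gword x (s : seq 'I_n) : R[i] := grec x (size s) s.

Lemma grec_size x m s : (size s <= m)%N -> grec x m s = gword x s.
Proof.
rewrite /gword; suff H p q t :
  (size t <= p)%N -> (size t <= q)%N -> grec x p t = grec x q t by move/H; apply.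
elim: p q t => [|p IHp] [|q] [|i1 [|i2 [|i3 [|i4 t]]]] //= ht hq.
by rewrite !(IHp q) //= ltnW // ?(ltnW ht) // ?(ltnW hq) // -ltnS ltnW.
Qed.

Lemma gword4 x (i1 i2 i3 i4 : 'I_n) (t : seq 'I_n) (s' := i4 :: t) :
  gword x [:: i1, i2, i3 & s'] =
    (gword x s' * a`_i3 * a`_i2 * a`_i1 + gword x s' * x3 x i3 i2 i1
     + (a`_i1 * gword x [:: i2, i3 & s'] + a`_i2 * gword x [:: i1, i3 & s']
        + a`_i3 * gword x [:: i1, i2 & s'])
     + gword x (i3 :: s') * x2 x i2 i1 - gword x (i2 :: s') * x2 x i3 i1
     + gword x (i1 :: s') * x2 x i3 i2
     - gword x s' * a`_i3 * x2 x i2 i1 - gword x s' * a`_i1 * x2 x i3 i2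
     - gword x (i1 :: s') * a`_i3 * a`_i2
     - gword x (i3 :: s') * a`_i2 * a`_i1) / 2.
Proof.
rewrite {1}/gword.
have -> m : grec x m.+1 [:: i1, i2, i3 & s'] =
    (grec x m s' * a`_i3 * a`_i2 * a`_i1 + grec x m s' * x3 x i3 i2 i1
     + (a`_i1 * grec x m [:: i2, i3 & s'] + a`_i2 * grec x m [:: i1, i3 & s']
        + a`_i3 * grec x m [:: i1, i2 & s'])
     + grec x m (i3 :: s') * x2 x i2 i1 - grec x m (i2 :: s') * x2 x i3 i1
     + grec x m (i1 :: s') * x2 x i3 i2
     - grec x m s' * a`_i3 * x2 x i2 i1 - grec x m s' * a`_i1 * x2 x i3 i2
     - grec x m (i1 :: s') * a`_i3 * a`_i2
     - grec x m (i3 :: s') * a`_i2 * a`_i1) / 2 by [].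
by rewrite !grec_size //= ltnW // ltnW.
Qed.

Definition Sset : set (trpoint R n) := [set x |
  [/\ forall i1 i2 i3 j1 j2 j3 : 'I_n,
        (i1 < i2 < i3)%N -> (j1 < j2 < j3)%N -> type1 x i1 i2 i3 j1 j2 j3 = 0,
      (4 <= n)%N -> forall i p0 p1 p2 p3 : 'I_n,
        [&& p0 < p1, p1 < p2 & p2 < p3]%N -> type2 x i p0 p1 p2 p3 = 0
    & (4 <= n)%N -> gword x (enum 'I_n) - a`_n = 0]].

End TraceCoordinates.

Section Moduli.
Variables (R : realType) (n : nat) (a : n.+1.-tuple R[i]).

Definition SL2 : set 'M[R[i]]_2 := [set P | \det P = 1].

Definition SL2tr (t : R[i]) : set 'M[R[i]]_2 := [set P | SL2 P /\ \tr P = t].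

Definition mtuple : Type := {ffun 'I_n -> 'M[R[i]]_2}.

Implicit Type M : mtuple.

(* rev_ord makes the product M_n * ... * M_1. *)
Definition Mlast M : 'M[R[i]]_2 := (\prod_(i < n) M (rev_ord i))^-1.

Definition reps : set mtuple := [set M : mtuple |
  (forall i : 'I_n, SL2tr a`_i (M i)) /\ SL2tr a`_n (Mlast M)].

Definition irreducible_tuple M : Prop :=
  forall U : {vspace 'cV[R[i]]_2},
    (forall (i : 'I_n) (v : 'cV[R[i]]_2), v \in U -> M i *m v \in U) ->
    U = 0%VS \/ U = fullv.

(* The class of M under simultaneous conjugation by SL2, as a set. *)
Definition conj_class M : set mtuple := [set N : mtuple |
  exists2 P : 'M[R[i]]_2, SL2 P & forall i : 'I_n, N i = P *m M i *m invmx P].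

Definition moduli : set (set mtuple) := conj_class @` reps.

Definition moduli_irr : set (set mtuple) :=
  conj_class @` (reps `&` irreducible_tuple).

(* enum lists the elements of a coordinate label in increasing order. *)
Definition traces M : trpoint R n :=
  [ffun A : {A : {set 'I_n} | is_coord A} =>
     \tr (\prod_(i <- rev (enum (val A))) M i)].

(* The trace coordinates of a class, read off on a representative; see
   Phi_class. *)
Definition Phi (c : set mtuple) : trpoint R n := traces (xget [ffun=> 0 : 'M[R[i]]_2] c).

Lemma traces_conj M N : conj_class M N -> traces N = traces M.
Proof.
case=> P detP NE; apply/ffunP => A; rewrite !ffunE.
have Pu : P \in unitmx by rewrite unitmxE detP unitr1.
suff -> s : \prod_(i <- s) N i = P *m (\prod_(i <- s) M i) *m invmx P.
  by rewrite mxtrace_mulC mulmxA mulVmx // mul1mx.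
elim: s => [|i s IHs]; first by rewrite !big_nil mulmx1 mulmxV.
rewrite !big_cons IHs NE -!mulmxE !mulmxA; congr (_ *m _ *m _).
by rewrite mulmxKV.
Qed.

Lemma conj_class_refl M : conj_class M M.
Proof.
exists 1%:M; first exact: det1.
by move=> i; rewrite mul1mx -[1%:M]/1 invmx1 mulmx1.
Qed.

Lemma Phi_class M : Phi (conj_class M) = traces M.
Proof.
by apply: traces_conj; apply: xgetPex; exists M; apply: conj_class_refl.
Qed.

End Moduli.

Section Charts.
Variables (R : realType) (n : nat) (a : n.+1.-tuple R[i]).
Implicit Types (x : trpoint R n) (i j k : 'I_n).

Definition psi (s t u : R[i]) : R[i] :=
  s ^+ 2 + t ^+ 2 + u ^+ 2 - s * t * u - 4.

(* J and K are the indices in their range 1, ..., n. *)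
Definition In_index j k : bool :=
  let J := j.+1 in let K := k.+1 in
  if J == 1%N then (2 <= K < n)%N
  else if (J < n)%N then (J < K <= n)%N
  else K == 1%N.

(* i0 = None stands for the chart with i_0 = 0. *)
Definition chart_index j k (i0 : option 'I_n) : bool :=
  In_index j k && (if i0 is Some i then (i != j) && (i != k) else true).

Definition pchart j k (i0 : option 'I_n) x : R[i] :=
  (x2 x k j ^+ 2 - 4) *
  (if i0 is Some i then psi (x3 a x k j i) (x2 x k j) a`_i
   else psi (x2 x k j) a`_k a`_j).

Definition Schart j k (i0 : option 'I_n) : set (trpoint R n) :=
  [set x | Sset a x /\ pchart j k i0 x <> 0].

Definition Mchart j k (i0 : option 'I_n) : set (set (mtuple R n)) :=
  [set c | moduli_irr a c /\ pchart j k i0 (Phi c) <> 0].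

Definition Sopen : set (trpoint R n) :=
  [set x | exists j k (i0 : option 'I_n),
     chart_index j k i0 /\ Schart j k i0 x].

Definition Mopen : set (set (mtuple R n)) :=
  [set c | exists j k (i0 : option 'I_n),
     chart_index j k i0 /\ Mchart j k i0 c].

Definition mx2 (u11 u12 u21 u22 : R[i]) : 'M[R[i]]_2 :=
  \matrix_(p, q) if p == 0 then (if q == 0 then u11 else u12)
                 else (if q == 0 then u21 else u22).

(* x_kjil, with l in the role of i_0. *)
Definition x4 x k j i (l : 'I_n) : R[i] :=
  (a`_k * a`_j * a`_i * a`_l + a`_k * x3 a x j i l + a`_j * x3 a x k i l
   + a`_i * x3 a x k j l + a`_l * x3 a x k j i + x2 x k j * x2 x i l
   - x2 x k i * x2 x j l + x2 x k l * x2 x j i - a`_k * a`_j * x2 x i l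
   - a`_k * a`_l * x2 x j i - a`_j * a`_i * x2 x k l
   - a`_l * a`_i * x2 x k j) / 2.

(* The (k, j; i0)-normal form of x, computed with the square root r of
   x_kj^2 - 4. *)
Definition normal_form j k (i0 : option 'I_n) x (r : R[i]) : mtuple R n :=
  let lp := (x2 x k j + r) / 2 in
  let lm := (x2 x k j - r) / 2 in
  let u11 i :=
    if i == j then - ((a`_k - lp * a`_j) / r)
    else if i == k then - ((a`_j - lp * a`_k) / r)
    else (x3 a x k j i - lm * a`_i) / r in
  let u22 i :=
    if i == j then (a`_k - lm * a`_j) / r
    else if i == k then (a`_j - lm * a`_k) / r
    else - ((x3 a x k j i - lp * a`_i) / r) in
  let off : 'I_n -> R[i] * R[i] :=
    match i0 with
    | None =>
        let psi1 := psi (x2 x k j) a`_k a`_j in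
        let u12j := - (psi1 / r ^+ 2) in
        let u21j := 1 in
        fun i =>
          if i == j then (u12j, u21j)
          else if i == k then (- (lp * u12j), - (lm * u21j))
          else ((x2 x k i - a`_k * u22 i
                 + lp * (x2 x j i - a`_j * u11 i)) / r,
                r * (x2 x k i - a`_k * u11 i
                     + lm * (x2 x j i - a`_j * u22 i)) / psi1)
    | Some l =>
        let psi0 := psi (x3 a x k j l) (x2 x k j) a`_l in
        let u12j := - ((x2 x k l - a`_k * u11 l
                        + lm * (x2 x j l - a`_j * u22 l)) / r) in
        let u21j := - (r * (x2 x k l - a`_k * u22 l
                            + lp * (x2 x j l - a`_j * u11 l)) / psi0) in
        fun i =>
          if i == j then (u12j, u21j)
          else if i == k then (- (lp * u12j), - (lm * u21j))
          else if i == l then (- (psi0 / r ^+ 2), 1)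
          else (- ((lm * x2 x i l + r * u11 i * u11 l - x4 x k j i l) / r),
                - (r * (lp * x2 x i l - r * u22 i * u22 l - x4 x k j i l)
                   / psi0))
    end in
  [ffun i => mx2 (u11 i) (off i).1 (off i).2 (u22 i)].

(* A choice, for each x in the chart, of the square root used in the normal
   form. *)
Definition sqrt_choice j k (i0 : option 'I_n) (r : trpoint R n -> R[i]) : Prop :=
  forall x, Schart j k i0 x -> r x ^+ 2 = x2 x k j ^+ 2 - 4.

Definition phi_chart j k (i0 : option 'I_n) (r : trpoint R n -> R[i])
    (x : trpoint R n) : set (mtuple R n) :=
  conj_class (normal_form j k i0 x (r x)).

End Charts.

(* Main.v *)
(* Write M_i = a_i/2 + X_i with X_i traceless.  Then z_ij and s_3(i,j,k) are the
   products tr(X_i X_j) and the triple products -2 tr(X_k X_j X_i) in the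
   quadratic space sl_2, and type 1 says that triple products multiply to Gram
   determinants.  On a chart some Gram determinant of order 2 of formal vectors
   is nonzero; two matrices realizing it, together with type 1, rebuild all the
   X_i, so each point x of a chart is the trace vector of some tuple.
   Conversely a tuple with trace vector x can be conjugated so that M_k M_j is
   diagonal and one lower left entry is 1; the traces then force every entry, and
   the result is the normal form.  Hence the class of the normal form is the
   whole fiber of the trace map over x, which does not depend on the chart. *)
Require Import Defs.
From mathcomp Require Import all_boot all_order all_algebra.
From mathcomp Require Import complex.
From mathcomp Require Import boolp classical_sets functions reals.
From mathcomp Require Import ring zify.

Set Implicit Arguments.
Unset Strict Implicit.
Unset Printing Implicit Defensive.

Import Order.TTheory GRing.Theory Num.Theory.
Local Open Scope ring_scope.

(** * Trace identities and simultaneous normalization of 2 by 2 matrices *)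

Section TwoByTwo.
Variable F : numClosedFieldType.
Implicit Types A B C D E P T : 'M[F]_2.

Lemma mxtrace2 A : \tr A = A 0 0 + A 1 1.
Proof.
rewrite /mxtrace !big_ord_recl big_ord0 addr0.
by congr (_ + A _ _); apply: val_inj.
Qed.

Lemma mulmx2E A B p q : (A *m B) p q = A p 0 * B 0 q + A p 1 * B 1 q.
Proof.
rewrite mxE !big_ord_recl big_ord0 addr0.
by congr (_ + A _ _ * B _ _); apply: val_inj.
Qed.

Lemma det2 A : \det A = A 0 0 * A 1 1 - A 0 1 * A 1 0.
Proof.
rewrite (expand_det_row _ 0) !big_ord_recl big_ord0 addr0 /cofactor /=.
rewrite !det_mx11 !mxE expr0 expr1 mul1r mulN1r mulrN.
by congr (_ * A _ _ - A _ _ * A _ _); apply: val_inj.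
Qed.

Lemma mx2_eq A B : A 0 0 = B 0 0 -> A 0 1 = B 0 1 -> A 1 0 = B 1 0 ->
  A 1 1 = B 1 1 -> A = B.
Proof.
move=> h00 h01 h10 h11; apply/matrixP => p q.
have E (s : 'I_2) : s = 0 \/ s = 1.
  by case: s => [[|[|//]] ?]; [left|right]; apply: val_inj.
by case: (E p) => ->; case: (E q) => ->.
Qed.

(** Expanded by hand over [nat] indices, so that concrete instances unfold to polynomials for
    [ring]. *)
Definition gram3 (f : nat -> nat -> F) : F :=
    f 0%N 0%N * (f 1%N 1%N * f 2%N 2%N - f 1%N 2%N * f 2%N 1%N)
  - f 0%N 1%N * (f 1%N 0%N * f 2%N 2%N - f 1%N 2%N * f 2%N 0%N)
  + f 0%N 2%N * (f 1%N 0%N * f 2%N 1%N - f 1%N 1%N * f 2%N 0%N).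

Lemma det3 (f : nat -> nat -> F) : \det (\matrix_(p < 3, q < 3) f p q) = gram3 f.
Proof.
rewrite (expand_det_row _ 0) !big_ord_recl big_ord0 /cofactor !det2 !mxE /=.
rewrite /gram3 /bump /=; ring.
Qed.

Definition dotm A B : F := \tr (A *m B) - \tr A * \tr B / 2.

Definition trip A B C : F :=
  \tr A * \tr (C *m B) + \tr B * \tr (C *m A) + \tr C * \tr (B *m A)
  - \tr C * \tr B * \tr A - 2 * \tr (C *m B *m A).

Lemma dotmC A B : dotm A B = dotm B A.
Proof. by rewrite /dotm mxtrace_mulC [\tr A * _]mulrC. Qed.

Lemma dotmE A B :
  dotm A B = (A 0 0 - A 1 1) * (B 0 0 - B 1 1) / 2 + A 0 1 * B 1 0 + A 1 0 * B 0 1.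
Proof. by rewrite /dotm !mxtrace2 !mulmx2E; field. Qed.

Lemma tripE A B C : trip A B C =
  (A 0 0 - A 1 1) * (B 0 1 * C 1 0 - B 1 0 * C 0 1)
  + (B 0 0 - B 1 1) * (C 0 1 * A 1 0 - C 1 0 * A 0 1)
  + (C 0 0 - C 1 1) * (A 0 1 * B 1 0 - A 1 0 * B 0 1).
Proof. by rewrite /trip !(mxtrace2, mulmx2E); ring. Qed.

Definition gramm A B C D E G : F :=
  gram3 (fun p q => dotm (nth 0 [:: A; B; C] p) (nth 0 [:: D; E; G] q)).

(** In the coordinates (A00 - A11, A01, A10), [trip] is a determinant and [dotm] has a matrix of
    determinant -1/2; multiply determinants. *)
Lemma trip_gram A B C D E G : trip A B C * trip D E G + 2 * gramm A B C D E G = 0.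
Proof. by rewrite /gramm /gram3 /= !tripE !dotmE; field. Qed.

(** Four vectors of a three-dimensional space satisfy Cramer's linear relation; pair it with [A]. *)
Lemma trip_dot A B C D E :
  dotm A B * trip C D E - dotm A C * trip B D E + dotm A D * trip B C E
  - dotm A E * trip B C D = 0.
Proof. by rewrite !tripE !dotmE; field. Qed.

(** Up to scaling, [trip_dot] with the cross product of [A] and [B] in its first two places,
    expanded by Lagrange's identity. It kills every triple product once those with [A], [B] vanish
    and their Gram determinant does not. *)
Lemma trip_span A B C D E :
  (dotm A A * dotm B B - dotm A B ^+ 2) * trip C D E
  = trip A B C * (dotm A D * dotm B E - dotm B D * dotm A E)
  + trip A B D * (dotm A E * dotm B C - dotm B E * dotm A C)
  + trip A B E * (dotm A C * dotm B D - dotm B C * dotm A D).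
Proof. by rewrite !tripE !dotmE; field. Qed.

Lemma mxtrace_mul4 A B C D : \tr (D *m C *m B *m A) =
  (\tr D * \tr C * \tr B * \tr A + \tr D * \tr (C *m B *m A)
   + (\tr A * \tr (D *m C *m B) + \tr B * \tr (D *m C *m A)
      + \tr C * \tr (D *m B *m A))
   + \tr (D *m C) * \tr (B *m A) - \tr (D *m B) * \tr (C *m A)
   + \tr (D *m A) * \tr (C *m B)
   - \tr D * \tr C * \tr (B *m A) - \tr D * \tr A * \tr (C *m B)
   - \tr (D *m A) * \tr C * \tr B - \tr (D *m C) * \tr B * \tr A) / 2.
Proof. by rewrite !(mxtrace2, mulmx2E); field. Qed.

(** The form that matches [x4] term by term, with the traces replaced by given values. *)
Lemma mxtrace_mul4_eq A B C D tA tB tC tD tDC tDB tDA tCB tCA tBA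
    tDCB tDCA tDBA tCBA :
  \tr A = tA -> \tr B = tB -> \tr C = tC -> \tr D = tD ->
  tDC = \tr (D *m C) -> tDB = \tr (D *m B) -> tDA = \tr (D *m A) ->
  tCB = \tr (C *m B) -> tCA = \tr (C *m A) -> tBA = \tr (B *m A) ->
  tDCB = \tr (D *m C *m B) -> tDCA = \tr (D *m C *m A) ->
  tDBA = \tr (D *m B *m A) -> tCBA = \tr (C *m B *m A) ->
  \tr (D *m C *m B *m A) =
    (tD * tC * tB * tA + tD * tCBA + tC * tDBA + tB * tDCA + tA * tDCB
     + tDC * tBA - tDB * tCA + tDA * tCB - tD * tC * tBA - tD * tA * tCB
     - tC * tB * tDA - tA * tB * tDC) / 2.
Proof.
do 4!move=> <-; do 10!move=> ->; rewrite mxtrace_mul4; congr (_ / 2).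
by move: (\tr _) (\tr _) (\tr _) => *; ring.
Qed.

Lemma dotm_det A : dotm A A = \tr A ^+ 2 / 2 - 2 * \det A.
Proof. by rewrite det2 /dotm !mxtrace2 !mulmx2E; field. Qed.

(** At determinant 1 the bracket is [psi] of the traces, so a nonzero [psi] excludes common
    eigenvectors. *)
Lemma det_comm2 A B : \det (A *m B - B *m A) =
  - (\tr (A *m B) ^+ 2 + \tr A ^+ 2 * \det B + \tr B ^+ 2 * \det A
     - \tr (A *m B) * \tr A * \tr B - 4 * (\det A * \det B)).
Proof.
rewrite !det2 !mxtrace2 !mulmx2E.
have E p q : (A *m B - B *m A) p q = (A *m B) p q - (B *m A) p q by rewrite !mxE.
by rewrite !E !mulmx2E; ring.
Qed.

Lemma mulmx_adj2 A B T : \det B = 1 -> A *m B = T ->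
  [/\ A 0 0 = T 0 0 * B 1 1 - T 0 1 * B 1 0, A 0 1 = T 0 1 * B 0 0 - T 0 0 * B 0 1,
      A 1 0 = T 1 0 * B 1 1 - T 1 1 * B 1 0 & A 1 1 = T 1 1 * B 0 0 - T 1 0 * B 0 1].
Proof.
move=> dB <-; have AE p q : A p q = A p q * \det B by rewrite dB mulr1.
by rewrite !mulmx2E; split; rewrite [LHS]AE det2; ring.
Qed.

Lemma invmx2_tr A : \det A = 1 -> \tr (invmx A) = \tr A.
Proof.
move=> dA; have Au : A \in unitmx by rewrite unitmxE dA unitr1.
rewrite /invmx Au dA invr1 scale1r !mxtrace2 !mxE /cofactor.
rewrite !det_mx11 !mxE /= !expr0 -signr_odd /= expr0 !mul1r addrC.
by congr (A _ _ + A _ _); apply: val_inj.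
Qed.

Lemma cayley2 A (l m : F) : l + m = \tr A -> l * m = \det A ->
  (A - l%:M) *m (A - m%:M) = 0.
Proof.
rewrite mxtrace2 det2 => ht hd.
have E p q t : (A - t%:M) p q = A p q - t *+ (p == q) by rewrite !mxE.
apply: mx2_eq; rewrite mulmx2E !E !mxE /= ?mulr1n ?mulr0n ?subr0.
- have -> : (A 0 0 - l) * (A 0 0 - m) + A 0 1 * A 1 0
     = A 0 0 * (A 0 0 + A 1 1 - (l + m))
       + (l * m - (A 0 0 * A 1 1 - A 0 1 * A 1 0)) by ring.
  by rewrite ht hd !subrr mulr0 addr0.
- have -> : (A 0 0 - l) * A 0 1 + A 0 1 * (A 1 1 - m)
     = A 0 1 * (A 0 0 + A 1 1 - (l + m)) by ring.
  by rewrite ht subrr mulr0.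
- have -> : A 1 0 * (A 0 0 - m) + (A 1 1 - l) * A 1 0
     = A 1 0 * (A 0 0 + A 1 1 - (l + m)) by ring.
  by rewrite ht subrr mulr0.
- have -> : A 1 0 * A 0 1 + (A 1 1 - l) * (A 1 1 - m)
     = A 1 1 * (A 0 0 + A 1 1 - (l + m))
       + (l * m - (A 0 0 * A 1 1 - A 0 1 * A 1 0)) by ring.
  by rewrite ht hd !subrr mulr0 addr0.
Qed.

(* The rows of P are an eigenvector w of D for lm and the component v of w *m E
   in the eigenline for lp, which is nonzero because w is not in the kernel of
   the commutator; rescaling P does not change the conjugates. *)
Lemma simul_normalize D E (lp lm : F) : lp != lm -> lp + lm = \tr D ->
    lp * lm = \det D -> \det (D *m E - E *m D) != 0 ->
  exists2 P, \det P = 1 &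
    P *m D *m invmx P = diag_mx (\row_p (if p == 0 then lp else lm))
    /\ (P *m E *m invmx P) 1 0 = 1.
Proof.
move=> nl ht hd nc.
have CH1 : (D - lm%:M) *m (D - lp%:M) = 0.
  by apply: cayley2; rewrite // 1?addrC // mulrC.
have CH2 : (D - lp%:M) *m (D - lm%:M) = 0 by apply: cayley2.
have dl : \det (D - lm%:M) == 0.
  apply/det0P.
  (* If [D] is scalar the commutator vanishes; otherwise a nonzero vector in the row space of
     [D - lp%:M] is killed by [D - lm%:M], by [CH2]. *)
  have [D0|] := eqVneq (D - lp%:M) 0.
    suff z : D *m E - E *m D = 0 by rewrite z det0 eqxx in nc.
    by move/subr0_eq: D0 => ->; rewrite scalar_mxC subrr.
  case/rowV0Pn => w /submxP[u ->] w0; exists (u *m (D - lp%:M)) => //.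
  by rewrite -mulmxA CH2 mulmx0.
have {dl} [w w0 hw] := det0P dl.
have n0 : lp - lm != 0 by rewrite subr_eq0.
pose v := (lp - lm)^-1 *: (w *m E *m (D - lm%:M)).
have hv : v *m (D - lp%:M) = 0.
  by rewrite /v -scalemxAl -(mulmxA (w *m E)) CH1 mulmx0 scaler0.
have vD : v *m D = lp *: v.
  by move: hv; rewrite mulmxBr mul_mx_scalar => /subr0_eq.
have wD : w *m D = lm *: w.
  by move: hw; rewrite mulmxBr mul_mx_scalar => /subr0_eq.
have vD' : v *m (D - lm%:M) = (lp - lm) *: v.
  by rewrite mulmxBr vD mul_mx_scalar scalerBl.
have wE : w *m E *m (D - lm%:M) = (lp - lm) *: v.
  by rewrite /v scalerA mulfV // scale1r.
clearbody v; have v0 : v != 0.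
  apply: contraNneq nc => v0; apply/det0P; exists w => //.
  rewrite mulmxBr !mulmxA wD -scalemxAl.
  move: wE; rewrite v0 scaler0 mulmxBr mul_mx_scalar => /subr0_eq ->.
  by rewrite subrr.
pose P0 : 'M[F]_2 := \matrix_p (if p == 0 then v else w).
have P00 : row 0 P0 = v by rewrite rowK.
have P01 : row 1 P0 = w by rewrite rowK.
have uP (u : 'rV_2) : u *m P0 = u 0 0 *: v + u 0 1 *: w.
  rewrite mulmx_sum_row !big_ord_recl big_ord0 addr0 -P00 -P01 /=.
  by have -> : lift ord0 ord0 = 1 :> 'I_2 by apply: val_inj.
have P0n : \det P0 != 0.
  apply/det0P => -[u u0]; rewrite uP => hu.
  have := congr1 (mulmx^~ (D - lm%:M)) hu.
  rewrite /= mulmxDl -!scalemxAl hw vD' scaler0 addr0 mul0mx => /eqP.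
  rewrite !scaler_eq0 (negbTE v0) (negbTE n0) !orbF => /eqP u00.
  move: hu; rewrite u00 scale0r add0r => /eqP.
  rewrite scaler_eq0 (negbTE w0) orbF => /eqP u01.
  case/eqP: u0; apply/rowP => p; rewrite mxE.
  case: p => [[|[|//]] ?]; [rewrite -u00 | rewrite -u01];
    by congr (u _ _); apply: val_inj.
have P0u : P0 \in unitmx by rewrite unitmxE unitfE.
have P0D : P0 *m D *m invmx P0 = diag_mx (\row_p (if p == 0 then lp else lm)).
  apply: (canLR (mulmxK P0u)); apply/row_matrixP => p.
  rewrite !row_mul row_diag_mx -scalemxAl -rowE !rowK mxE.
  by case: ifP.
have P0E : (P0 *m E *m invmx P0) 1 0 = 1.
  set N := P0 *m E *m invmx P0.
  (* Multiplying by [D - lm%:M] kills the [w] component, so the coefficient of [v] in the second row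
     can be compared with 1. *)
  have : row 1 N *m P0 *m (D - lm%:M) = (lp - lm) *: v.
    by rewrite -row_mul mulmxKV // row_mul P01.
  rewrite uP mulmxDl -!scalemxAl hw vD' scaler0 addr0 scalerA.
  move/eqP; rewrite -subr_eq0 -scalerBl scaler_eq0 (negbTE v0) orbF.
  rewrite -{2}(mul1r (lp - lm)) -mulrBl mulf_eq0 (negbTE n0) orbF subr_eq0.
  by rewrite mxE => /eqP.
pose s := sqrtC (\det P0)^-1.
have s2 : s ^+ 2 = (\det P0)^-1 by rewrite sqrtCK.
have s0 : s != 0 by rewrite -sqrf_eq0 s2 invr_eq0.
have sP A : (s *: P0) *m A *m invmx (s *: P0) = P0 *m A *m invmx P0.
  rewrite invmxZ ?unitfE // -?scalemxAl -?scalemxAr ?scalerA ?mulfV ?scale1r //.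
  by rewrite unitmxZ ?unitfE.
exists (s *: P0); first by rewrite detZ s2 mulVf.
by rewrite !sP.
Qed.

End TwoByTwo.

(** * Increasing enumerations of index sets *)

Section OrdinalEnumeration.
Variable n : nat.
Implicit Types (A : {set 'I_n}) (i j k : 'I_n).

Local Notation ltI := (fun i j : 'I_n => (i < j)%N).

Lemma ltI_trans : transitive ltI.
Proof. by move=> j i k; apply: ltn_trans. Qed.

Lemma sorted_enum_ord (A : {pred 'I_n}) : sorted ltI (enum A).
Proof.
rewrite /enum_mem -enumT; apply: (sorted_filter ltI_trans).
by have := iota_ltn_sorted 0 n; rewrite -val_enum_ord sorted_map.
Qed.

Lemma enum_set_sorted A (s : seq 'I_n) : sorted ltI s -> A =i s -> enum A = s.
Proof.
move=> ss As; apply: (irr_sorted_eq ltI_trans) => [p|||p].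
- exact: ltnn.
- exact: sorted_enum_ord.
- by [].
- by rewrite mem_enum As.
Qed.

Lemma enum_set2 i j : (i < j)%N -> enum [set j; i]%SET = [:: i; j].
Proof.
move=> ij; apply: enum_set_sorted => [|p]; first by rewrite /= ij.
by rewrite !inE orbC.
Qed.

Lemma enum_set3 i j k : (i < j < k)%N -> enum [set k; j; i]%SET = [:: i; j; k].
Proof.
move=> ijk; apply: enum_set_sorted => [|p]; first by rewrite /= andbT.
by rewrite !inE [RHS]orbC -orbA [RHS]orbAC; do 3!case: eqP.
Qed.

(** Both lists are strictly decreasing with the same members; this turns the product over [rev_ord]
    in [Mlast] into one over a reversed list. *)
Lemma rev_enum_ord : rev (enum 'I_n) = map (@rev_ord n) (enum 'I_n).
Proof.
have gtr : transitive (fun i j : 'I_n => (j < i)%N).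
  by move=> j i k ji ik; apply: ltn_trans ik ji.
apply: (irr_sorted_eq gtr) => [i|||i].
- exact: ltnn.
- by rewrite rev_sorted; apply: sorted_enum_ord.
- rewrite sorted_map; apply: sub_sorted (sorted_enum_ord _) => i j /= ij.
  by rewrite ltn_sub2l // (leq_ltn_trans _ (ltn_ord j)).
- rewrite mem_rev mem_enum inE; apply/esym/mapP; exists (rev_ord i).
    by rewrite mem_enum.
  by rewrite rev_ordK.
Qed.

(** Adjacent transpositions sort any triple, and a tie in a sorted triple can be moved to the first
    two places. *)
Lemma triple_ind (P : 'I_n -> 'I_n -> 'I_n -> Prop) :
    (forall i j k, P i j k -> P j i k) -> (forall i j k, P i j k -> P i k j) ->
    (forall i k, P i i k) -> (forall i j k, (i < j < k)%N -> P i j k) ->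
  forall i j k, P i j k.
Proof.
move=> s12 s23 Pd Plt.
have Ple i j k : (i <= j <= k)%N -> P i j k.
  rewrite leq_eqVlt [(j <= k)%N]leq_eqVlt.
  case: eqP => [/val_inj -> // | _] /=.
  case: eqP => [/val_inj -> _ | _ /= h]; last exact: Plt.
  by apply/s12/s23.
move=> i j k.
case: (leqP i j) => [ij|/ltnW ji]; case: (leqP j k) => [jk|/ltnW kj];
  case: (leqP i k) => [ik|/ltnW ki].
- by apply: Ple; rewrite ij.
- by apply: Ple; rewrite ij.
- by apply/s23/Ple; rewrite ik.
- by apply/s23/s12/Ple; rewrite ki.
- by apply/s12/Ple; rewrite ji.
- by apply/s12/s23/Ple; rewrite jk.
- by apply/s23/Ple; rewrite ik.
- by apply/s12/s23/s12/Ple; rewrite kj.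
Qed.

End OrdinalEnumeration.

(** * Trace coordinates of a tuple and the polynomials [gword] *)

Section Coordinates.
Variables (R : realType) (n : nat) (a : n.+1.-tuple R[i]).
Implicit Types (x : trpoint R n) (i j k : 'I_n) (M : mtuple R n).

Lemma x2C x i j : x2 x j i = x2 x i j.
Proof. by rewrite /x2 finset.setUC. Qed.

Lemma x3base_swap12 x i j k : x3base a x k i j = x3base a x k j i.
Proof. by rewrite /x3base -!finset.setUA (finset.setUC [set i]%SET). Qed.

Lemma x3base_cyc x i j k : x3base a x j i k = x3base a x k j i.
Proof. by rewrite /x3base finset.setUC finset.setUA. Qed.

Lemma x3_cyc x i j k : x3 a x j i k = x3 a x k j i.
Proof.
rewrite /x3 x3base_cyc (x2C x i k) (x2C x j k).
by case: ifP => h1; case: ifP => h2 //; [lia|lia|ring].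
Qed.

(** For distinct indices exactly one of the two orders passes the cyclic test in [x3]. *)
Lemma x3_swap12 x i j k : uniq [:: i; j; k] ->
  x3 a x k i j = a`_k * x2 x j i + a`_j * x2 x k i + a`_i * x2 x k j
       - a`_k * a`_j * a`_i - x3 a x k j i.
Proof.
rewrite /= !inE negb_or andbT -!(inj_eq val_inj) /= => u.
rewrite /x3 x3base_swap12 (x2C x j i).
by case: ifP => h1; case: ifP => h2; [lia|ring|ring|lia].
Qed.

(** The last matrix is absent: for n = 3 its trace condition is contained in the third clause
    through [x3base], for larger n it is recovered from [gword]. *)
Definition realizes x M : Prop :=
  [/\ forall i, SL2tr a`_i (M i),
      forall i j, i != j -> x2 x j i = \tr (M j *m M i)
    & forall i j k, uniq [:: i; j; k] -> x3 a x k j i = \tr (M k *m M j *m M i)].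

(** Any word of distinct letters is reached from the increasing one by adjacent swaps, and traces of
    2 by 2 matrices obey the same swap and rotation rules as [x3]. *)
Lemma realizes_lt x M : (forall i, SL2tr a`_i (M i)) ->
    (forall i j, (i < j)%N -> x2 x j i = \tr (M j *m M i)) ->
    (forall i j k, (i < j < k)%N -> x3base a x k j i = \tr (M k *m M j *m M i)) ->
  realizes x M.
Proof.
move=> h1 h2 h3.
have {}h2 i j : i != j -> x2 x j i = \tr (M j *m M i).
  rewrite -(inj_eq val_inj) /= neq_ltn => /orP[/h2 //|/h2].
  by rewrite x2C mxtrace_mulC.
split=> //; apply: triple_ind.
- move=> i j k IH u.
  have u' : uniq [:: i; j; k].
    by move: u; rewrite /= !inE !negb_or eq_sym andbT -!andbA => /and3P[-> -> ->].
  rewrite (x3_swap12 x u') (IH u').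
  move: u'; rewrite /= !inE !negb_or andbT -!andbA => /and3P[ij ik jk].
  rewrite !h2 //; case: (h1 i) => _ <-; case: (h1 j) => _ <-; case: (h1 k) => _ <-.
  by rewrite !(mxtrace2, mulmx2E); ring.
- move=> i j k IH u.
  have u' : uniq [:: i; j; k].
    move: u; rewrite /= !inE !negb_or (eq_sym k j) andbT -!andbA.
    by move=> /and3P[-> -> ->].
  rewrite -x3_cyc (x3_swap12 x u') (IH u').
  move: u'; rewrite /= !inE !negb_or andbT -!andbA => /and3P[ij ik jk].
  rewrite !h2 //.
  case: (h1 i) => _ <-; case: (h1 j) => _ <-; case: (h1 k) => _ <-.
  by rewrite !(mxtrace2, mulmx2E); ring.
- by move=> i k; rewrite /= inE eqxx.
- by move=> i j k ijk _; rewrite /x3 ijk h3.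
Qed.

Lemma trcoord_traces M (A : {set 'I_n}) : is_coord A ->
  trcoord (traces M) A = \tr (\prod_(i <- rev (enum A)) M i).
Proof. by move=> cA; rewrite /trcoord insubT /= ffunE. Qed.

Lemma prod_rev2 M i j : \prod_(p <- rev [:: i; j]) M p = M j *m M i.
Proof. by rewrite /rev /= !big_cons big_nil mulr1. Qed.

Lemma prod_rev3 M i j k : \prod_(p <- rev [:: i; j; k]) M p = M k *m M j *m M i.
Proof. by rewrite /rev /= !big_cons big_nil mulr1 -mulmxA. Qed.

Lemma MlastE M : Mlast M = invmx (\prod_(i <- rev (enum 'I_n)) M i).
Proof. by rewrite /Mlast rev_enum_ord big_map enumT [index_enum _]unlock. Qed.

Lemma prod_rev_cons M i (s : seq 'I_n) :
  \prod_(p <- rev (i :: s)) M p = \prod_(p <- rev s) M p *m M i.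
Proof. by rewrite rev_cons big_rcons. Qed.

(** The recursion for [gword] is [mxtrace_mul4] with [D] the product over the tail and [A], [B], [C]
    the matrices of the first three letters. *)
Lemma gword_tr x M (s : seq 'I_n) : realizes x M ->
  sorted (fun i j : 'I_n => (i < j)%N) s -> s != [::] ->
  gword a x s = \tr (\prod_(i <- rev s) M i).
Proof.
case=> h1 h2 h3; move: {2}(size s) (leqnn (size s)) => m.
elim: m s => [|m IH] s; first by rewrite leqn0 size_eq0 => /eqP->.
case: s => [//|i1 [|i2 [|i3 [|i4 t]]]] sm ss _.
- by rewrite /gword /= /rev /= big_seq1; case: (h1 i1) => _ ->.
- rewrite prod_rev2 /gword /= h2 //; move: ss; rewrite /= andbT.
  by apply: contraTneq => ->; rewrite ltnn.
- rewrite prod_rev3 /gword /= h3 //.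
  by apply: (sorted_uniq (@ltI_trans n)) ss => i; apply: ltnn.
have u : uniq [:: i1, i2, i3, i4 & t].
  by apply: (sorted_uniq (@ltI_trans n)) ss => i; apply: ltnn.
rewrite gword4; set s' := i4 :: t.
have sub q : subseq q [:: i1, i2, i3 & s'] -> (size q <= m)%N -> q != [::] ->
    gword a x q = \tr (\prod_(i <- rev q) M i).
  by move=> qs qm; apply: IH => //; apply: subseq_sorted qs ss; apply: ltI_trans.
have u3 : uniq [:: i1; i2; i3].
  by apply: subseq_uniq u; apply: (@prefix_subseq _ [:: i1; i2; i3]).
have sz : (size t + 3 <= m)%N by rewrite addn3.
(* [b] selects which of the first three letters stay in front of the tail; keeping at most two
   shortens the word, so induction applies. *)
have sbI (b : bitseq) (q := mask b [:: i1; i2; i3]) : (size q <= 2)%N ->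
    gword a x (q ++ s') = \tr (\prod_(i <- rev (q ++ s')) M i).
  move=> q2; apply: sub; last by case: (q).
    by apply: (@cat_subseq _ q s' [:: i1; i2; i3] s'); first exact: mask_subseq.
  by apply: leq_trans sz; rewrite size_cat addnC addSnnS leq_add2l.
have /= -> := sbI [::] isT; have /= -> := sbI [:: true] isT.
have /= -> := sbI [:: false; true] isT.
have /= -> := sbI [:: false; false; true] isT.
have /= -> := sbI [:: false; true; true] isT; have /= -> := sbI [:: true; true] isT.
have /= -> := sbI [:: true; false; true] isT.
move: u3; rewrite /= !inE !negb_or andbT -!andbA => /and3P[ij ik jk].
rewrite h3 ?h2 //; last by rewrite /= !inE !negb_or ij ik jk.
rewrite !prod_rev_cons; case: (h1 i1) => _ <-; case: (h1 i2) => _ <-.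
case: (h1 i3) => _ <-.
by rewrite [LHS in _ = LHS]mxtrace_mul4; congr (_ / 2); ring.
Qed.

Lemma realizes_traces M : (3 <= n)%N -> reps a M -> realizes (traces M) M.
Proof.
move=> n3 [hM [hl tl]].
have dP (s : seq 'I_n) : \det (\prod_(i <- s) M i) = 1.
  elim: s => [|i s IH]; first by rewrite big_nil det1.
  by rewrite big_cons -mulmxE det_mulmx IH mulr1; case: (hM i).
apply: realizes_lt => // [i j ij|i j k ijk].
  have ne : i != j by apply: contraTneq ij => ->; rewrite ltnn.
  rewrite /x2 trcoord_traces ?enum_set2 ?prod_rev2 // /is_coord cards2.
  by rewrite (eq_sym j) ne.
have cA : #|[set k; j; i]%SET| = 3 by rewrite cardE enum_set3.
(* For n = 3 the coordinate is the constant a_4, the trace of [Mlast]; in SL2 inverse matrices have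
   equal traces. *)
rewrite /x3base; case: eqP => [n_eq|/eqP n_ne].
  rewrite -tl MlastE invmx2_tr // -prod_rev3 -(enum_set3 ijk).
  suff -> : [set k; j; i]%SET = [set: 'I_n]%SET.
    by congr (\tr (\prod_(p <- rev _) _)); apply: eq_enum => p; rewrite !inE.
  by apply/eqP; rewrite eqEcard finset.subsetT /= cardsT card_ord cA n_eq.
rewrite trcoord_traces ?enum_set3 ?prod_rev3 // /is_coord cA eqxx andbT orbC.
by rewrite ltn_neqAle eq_sym n_ne n3.
Qed.

Lemma traces_realizes x M : (3 <= n)%N -> realizes x M ->
    gword a x (enum 'I_n) = a`_n ->
  reps a M /\ traces M = x.
Proof.
move=> n3 rM gn; have [h1 h2 h3] := rM.
have dP (s : seq 'I_n) : \det (\prod_(i <- s) M i) = 1.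
  elim: s => [|i s IH]; first by rewrite big_nil det1.
  by rewrite big_cons -mulmxE det_mulmx IH mulr1; case: (h1 i).
have en : enum 'I_n != [::].
  by rewrite -size_eq0 size_enum_ord -lt0n; apply: leq_trans n3.
split.
  split=> //; rewrite MlastE; split; first by rewrite /SL2 /= det_inv dP invr1.
  by rewrite invmx2_tr // -gn (gword_tr rM) //; apply: sorted_enum_ord.
apply/ffunP => -[A cA]; rewrite ffunE /=.
have <- : trcoord x A = x (exist _ A cA).
  by rewrite /trcoord insubT.
have := cardE A; have := sorted_enum_ord A; have := set_enum A.
move: (cA) => /orP[|/andP[n4]] /eqP ->;
  case: (enum A) => [|i [|j [|k [|//]]]] // <-.
  rewrite /= andbT => ij _.
  have -> : [set p in [:: i; j]]%SET = [set j; i]%SET.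
    by apply/setP => p; rewrite !inE orbC.
  rewrite prod_rev2 -h2 //.
  by apply: contraTneq ij => ->; rewrite ltnn.
rewrite /= andbT => ijk _.
have -> : [set p in [:: i; j; k]]%SET = [set k; j; i]%SET.
  by apply/setP => p; rewrite !inE; do 3!case: eqP.
rewrite prod_rev3 -h3.
  rewrite /x3 ijk /x3base; case: eqP => // n_eq; by rewrite n_eq in n4.
apply: (sorted_uniq (@ltI_trans n)); last by rewrite /= andbT.
by move=> p; apply: ltnn.
Qed.

(** Type 3 gives this for n >= 4; for n = 3 the full word has three letters and its value is the
    convention x_321 = a_4. *)
Lemma gword_Sset x : (3 <= n)%N -> Sset a x -> gword a x (enum 'I_n) = a`_n.
Proof.
move=> n3 [_ _ h]; have [n4|] := leqP 4 n; first by apply/eqP; rewrite -subr_eq0 h.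
move=> n4; have {n3 n4} n3 : n = 3 by apply/eqP; rewrite eqn_leq n3 -ltnS n4.
have := etrans (size_enum_ord n) n3; have := sorted_enum_ord 'I_n.
case: (enum _) => [|i [|j [|k [|//]]]] //=; rewrite andbT => ijk _.
by rewrite /gword /= /x3 ijk /x3base (introT eqP n3).
Qed.

End Coordinates.

(** Certificate for an ideal membership: the cofactors are supplied, spare slots are filled with 0,
    and the remaining identity is left to [ring]. *)
Lemma eq0_lincomb4 (F : comNzRingType) (c1 c2 c3 c4 u1 u2 u3 u4 v : F) :
  u1 = 0 -> u2 = 0 -> u3 = 0 -> u4 = 0 ->
  v = c1 * u1 + c2 * u2 + c3 * u3 + c4 * u4 -> v = 0.
Proof. by move=> -> -> -> -> ->; rewrite !mulr0 !addr0. Qed.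

(** * Matrices with prescribed Gram matrix and triple products *)

Section Realization.
Variables (R : realType).
Local Notation F := (R[i]).

Lemma mx2E (u11 u12 u21 u22 : F) : let A := mx2 u11 u12 u21 u22 in
  ((A 0 0 = u11) * (A 0 1 = u12) * (A 1 0 = u21) * (A 1 1 = u22))%type.
Proof. by rewrite /= !mxE. Qed.

Definition gramz (I : Type) (z : I -> I -> F) i1 i2 i3 j1 j2 j3 : F :=
  gram3 (fun p q => z (nth i1 [:: i1; i2; i3] p) (nth j1 [:: j1; j2; j3] q)).

(* X_i is determined by its products with V and W, which realize the Gram matrix
   of the formal vectors al e_p + be e_r and e_q, and by the triple product
   trip V W X_i.  The products of the X_i are then forced by [hs]. *)
Lemma gram_realization (I : finType) (t : I -> F) (z : I -> I -> F)
    (s : I -> I -> I -> F) (al be : F) (p r q : I) :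
    (forall i j, z i j = z j i) ->
    (forall i1 i2 i3 j1 j2 j3,
       s i1 i2 i3 * s j1 j2 j3 + 2 * gramz z i1 i2 i3 j1 j2 j3 = 0) ->
    (al ^+ 2 * z p p + 2 * al * be * z p r + be ^+ 2 * z r r) * z q q
      - (al * z p q + be * z r q) ^+ 2 != 0 ->
  exists M : I -> 'M[F]_2, [/\ forall i, \tr (M i) = t i,
    forall i j, dotm (M i) (M j) = z i j
    & forall i j k, trip (M i) (M j) (M k) = s i j k].
Proof.
move=> zC hs; set A := (X in X * z q q); set B := al * z p q + be * z r q.
pose c := sqrtC (z q q / 2).
have cE : z q q = 2 * c ^+ 2 by rewrite sqrtCK mulrC divfK // pnatr_eq0.
pose d := 2 * c ^+ 2 * A - B ^+ 2; rewrite cE mulrC -/d => d0.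
(* Formal counterparts of [dotm V (M i)] and [trip V W (M i)], by linearity in al e_p + be e_r. Then
   [Tv] and [Ts] are formal instances of [trip_gram], obtained by expanding [hs]. *)
pose zv i := al * z p i + be * z r i.
pose sv i := al * s p q i + be * s r q i.
have Tv i l : sv i * sv l + 2 * (A * (z q q * z i l - z q l * z i q)
    - B * (B * z i l - z q l * zv i) + zv l * (B * z i q - z q q * zv i)) = 0.
  have := hs p q i p q l; have := hs r q i r q l.
  have := hs p q i r q l; have := hs r q i p q l.
  rewrite /gramz /gram3 /= (zC q p) (zC q r) (zC r p) (zC i p) (zC i r).
  move=> h1 h2 h3 h4; rewrite /sv /zv /A /B.
  apply: (@eq0_lincomb4 _ (al * be) (al * be) (be ^+ 2) (al ^+ 2) _ _ _ _ _
            h1 h2 h3 h4).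
  ring.
have Ts i l m k : s i l m * sv k + 2 *
    (zv i * (z l q * z m k - z l k * z m q) - z i q * (zv l * z m k - z l k * zv m)
     + z i k * (zv l * z m q - z l q * zv m)) = 0.
  have := hs i l m p q k; have := hs i l m r q k.
  rewrite /gramz /gram3 /= !(zC _ p) !(zC _ r) => h1 h2; rewrite /sv /zv.
  apply: (@eq0_lincomb4 _ be al 0 0 _ _ _ _ _ h1 h2 erefl erefl).
  ring.
(* Cramer's rule: once [X3] is eliminated, the conditions [WM] and [VWM] below form a linear system
   in [X1], [X2] of determinant [d]. *)
pose X2 i := (2 * c * (sv i / 2 + c * zv i) - B * z q i) / d.
pose X1 i := (z q i * c * A - B * (sv i / 2 + c * zv i)) / d.
pose X3 i := zv i - X2 i * A / 2.
pose M i := mx2 (t i / 2 + X1 i) (X2 i) (X3 i) (t i / 2 - X1 i).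
pose V := mx2 0 1 (A / 2) 0; pose W := mx2 c 0 B (- c).
have VV : dotm V V = A by rewrite dotmE !mx2E; field.
have VW : dotm V W = B by rewrite dotmE !mx2E; field.
have WW : dotm W W = z q q by rewrite dotmE !mx2E cE; field.
have VM i : dotm V (M i) = zv i.
  by rewrite dotmE !mx2E /X3; field.
have WM i : dotm W (M i) = z q i.
  rewrite dotmE !mx2E /X1 /X2 /d; move: d0; rewrite /d; clearbody A B => d0.
  by field.
have VWM i : trip V W (M i) = sv i.
  rewrite tripE !mx2E /X3 /X1 /X2 /d; move: d0; rewrite /d; clearbody A B => d0.
  by field.
have MM i l : dotm (M i) (M l) = z i l.
  have := trip_gram V W (M i) V W (M l).
  rewrite /gramm /gram3 /= !VWM VV VW WW (dotmC W V) VW !(dotmC (M i)) !VM !WM.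
  move=> h1; have h2 := Tv i l; rewrite (zC i q) cE in h1 h2.
  (* Subtract the matrix identity from [Tv]: all other terms agree, and the unknown product has
     coefficient 2 d. *)
  have : 2 * d * (z i l - dotm (M l) (M i)) = 0.
    apply: (@eq0_lincomb4 _ 1 (- 1) 0 0 _ _ _ _ _ h2 h1 erefl erefl).
    by rewrite /d; ring.
  by move/eqP; rewrite !mulf_eq0 pnatr_eq0 (negbTE d0) subr_eq0 /= => /eqP ->.
exists M; split=> // [i|i l m].
  by rewrite mxtrace2 !mx2E; field.
(* A nonzero [sv k] can be cancelled in [Ts]. If there is none, [trip_span] makes the matrix triple
   product vanish, and [hs] makes the square of [s i l m] vanish. *)
have [k sk|s0] := pickP (fun k => sv k != 0).
  apply: (mulIf sk); have := Ts i l m k.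
  rewrite -{1}(VWM k); have := trip_gram (M i) (M l) (M m) V W (M k).
  rewrite /gramm /gram3 /= VWM !(dotmC _ V) !(dotmC _ W) !VM !WM !MM.
  rewrite (zC l q) (zC m q) (zC i q) => <- /eqP.
  by rewrite (inj_eq (addIr _)) => /eqP ->.
have sv0 k : trip V W (M k) = 0 by rewrite VWM; apply/eqP/negbFE/s0.
have T0 : trip (M i) (M l) (M m) = 0.
  have := trip_span V W (M i) (M l) (M m); rewrite !sv0 !mul0r !addr0 VV VW WW cE.
  by rewrite (mulrC A) -/d => /eqP; rewrite mulf_eq0 (negbTE d0) /= => /eqP.
have := hs i l m i l m; have := trip_gram (M i) (M l) (M m) (M i) (M l) (M m).
rewrite /gramm /gramz /gram3 /= !MM T0 mul0r add0r => -> /eqP.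
by rewrite addr0 mulf_eq0 orbb => /eqP.
Qed.
End Realization.

(** * The algebraic set, its charts and the existence of realizing tuples *)

Section AlgebraicSet.
Variables (R : realType) (n : nat) (a : n.+1.-tuple R[i]).
Implicit Types (x : trpoint R n) (i j k l : 'I_n) (M : mtuple R n).

Lemma zzC x i j : zz a x i j = zz a x j i.
Proof. by rewrite /zz eq_sym x2C [a`_i * _]mulrC; case: eqP => // ->. Qed.

Lemma type1E x i1 i2 i3 j1 j2 j3 : type1 a x i1 i2 i3 j1 j2 j3 =
  s3 a x i1 i2 i3 * s3 a x j1 j2 j3 + 2 * gramz (zz a x) i1 i2 i3 j1 j2 j3.
Proof.
rewrite /type1 /gramz -det3; congr (_ + 2 * \det _); apply/matrixP => p q.
by rewrite !mxE (tnth_nth i1) (tnth_nth j1).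
Qed.

(* s3 extended to repeated indices, where its formula involves junk coordinates. *)
Definition s3alt x i j k := if uniq [:: i; j; k] then s3 a x i j k else 0.

Lemma uniq_swap12 i j k : uniq [:: j; i; k] = uniq [:: i; j; k].
Proof. by apply: perm_uniq; rewrite (perm_catCA [:: j] [:: i] [:: k]). Qed.

Lemma uniq_swap23 i j k : uniq [:: i; k; j] = uniq [:: i; j; k].
Proof. by apply: perm_uniq; rewrite perm_cons (perm_catC [:: k] [:: j]). Qed.

Lemma uniq_lt i j k : (i < j < k)%N -> uniq [:: i; j; k].
Proof.
move=> ijk; apply: (sorted_uniq (@ltI_trans n)); last by rewrite /= andbT.
by move=> p; apply: ltnn.
Qed.

Lemma s3alt_swap12 x i j k : s3alt x j i k = - s3alt x i j k.
Proof.
rewrite /s3alt uniq_swap12; case: ifP => u; last by rewrite oppr0.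
by rewrite /s3 x3_swap12 // (x2C x i j); ring.
Qed.

Lemma s3alt_swap23 x i j k : s3alt x i k j = - s3alt x i j k.
Proof.
rewrite /s3alt uniq_swap23; case: ifP => u; last by rewrite oppr0.
by rewrite /s3 -x3_cyc x3_swap12 // (x2C x j k); ring.
Qed.

(** Both terms alternate in each index triple, so only increasing triples matter; a repeated index
    gives the Gram determinant two equal rows or columns. *)
Lemma s3alt_type1 x i1 i2 i3 j1 j2 j3 : Sset a x ->
  s3alt x i1 i2 i3 * s3alt x j1 j2 j3
  + 2 * gramz (zz a x) i1 i2 i3 j1 j2 j3 = 0.
Proof.
case=> h1 _ _; move: i1 i2 i3; apply: triple_ind.
- move=> i1 i2 i3 IH; rewrite s3alt_swap12 /gramz /gram3 /=.
  by rewrite -[RHS]oppr0 -[in RHS]IH /gramz /gram3 /=; ring.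
- move=> i1 i2 i3 IH; rewrite s3alt_swap23 /gramz /gram3 /=.
  by rewrite -[RHS]oppr0 -[in RHS]IH /gramz /gram3 /=; ring.
- move=> i k; rewrite /s3alt /= inE eqxx /= mul0r /gramz /gram3 /=; ring.
move=> i1 i2 i3 hi; have ui := uniq_lt hi.
move: j1 j2 j3; apply: triple_ind.
- move=> j1 j2 j3 IH; rewrite (s3alt_swap12 _ j1) /gramz /gram3 /=.
  by rewrite -[RHS]oppr0 -[in RHS]IH /gramz /gram3 /=; ring.
- move=> j1 j2 j3 IH; rewrite (s3alt_swap23 _ j1) /gramz /gram3 /=.
  by rewrite -[RHS]oppr0 -[in RHS]IH /gramz /gram3 /=; ring.
- move=> j k; rewrite [s3alt x j j k]/s3alt /= inE eqxx /= mulr0.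
  by rewrite /gramz /gram3 /=; ring.
move=> j1 j2 j3 hj; by rewrite /s3alt ui (uniq_lt hj) -type1E h1.
Qed.

Lemma chart_index_neq j k (i0 : option 'I_n) : (3 <= n)%N -> chart_index j k i0 ->
  j != k /\ (if i0 is Some l then (l != j) && (l != k) else true) = true.
Proof.
move=> n3 /andP[hI h0]; split; last by case: (i0) h0.
apply: contraTneq hI => ->; rewrite /In_index; have := ltn_ord k.
by case: ifP => h1; [|case: ifP => h2]; lia.
Qed.

(** By contraposition: if all these Gram determinants vanish, so do all mixed minors, hence also the
    triple product [s], whose square is a combination of minors; the [psi] factor of the chart is
    then a combination of minors too. *)
Lemma chart_nondegenerate x j k (i0 : option 'I_n) : j != k ->
    (if i0 is Some l then (l != j) && (l != k) else true) = true ->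
    Sset a x -> pchart a j k i0 x <> 0 ->
  exists al be p r q, let z := zz a x in
    (al ^+ 2 * z p p + 2 * al * be * z p r + be ^+ 2 * z r r) * z q q
      - (al * z p q + be * z r q) ^+ 2 != 0.
Proof.
move=> jk hl Sx px; apply/not_existsP => h; apply: px.
have {}h al be p r q : let z := zz a x in
    (al ^+ 2 * z p p + 2 * al * be * z p r + be ^+ 2 * z r r) * z q q
      - (al * z p q + be * z r q) ^+ 2 = 0.
  by apply/eqP/negPn/negP => h'; apply: (h al); exists be, p, r, q.
have kj : k != j by rewrite eq_sym.
pose z := zz a x; pose m p r q := z p r * z q q - z p q * z r q.
have m0 p q : m p p q = 0 by rewrite -[RHS](h 1 0 p p q) /m /z /=; ring.
(* Polarization: al = be = 1 gives m p p q + 2 m p r q + m r r q. *)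
have m1 p r q : m p r q = 0.
  suff h2 : 2 * m p r q = 0.
    by move/eqP: h2; rewrite mulf_eq0 pnatr_eq0 => /eqP.
  apply: (@eq0_lincomb4 _ 1 (- 1) (- 1) 0 _ _ _ _ _
            (h 1 1 p r q) (m0 p q) (m0 r q) erefl).
  by rewrite /m /z /=; ring.
rewrite /pchart; case: i0 hl => [l /andP[lj lk]|_]; last first.
  suff -> : psi (x2 x k j) a`_k a`_j = - m j j k by rewrite m1 oppr0 mulr0.
  by rewrite /m /z /zz !eqxx (negbTE jk) (x2C x k j) /psi; field.
have jl : j != l by rewrite eq_sym.
have kl : k != l by rewrite eq_sym.
have u : uniq [:: j; k; l] by rewrite /= !inE !negb_or jk jl kl.
set s := s3 a x j k l.
have s0 : s = 0.
  have := s3alt_type1 j k l j k l Sx; rewrite /s3alt u -/s.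
  suff -> : gramz (zz a x) j k l j k l =
      z j j * m k k l - z j k * m j k l - z j l * m j l k.
    by rewrite !m1 !mulr0 !subr0 mulr0 addr0 => /eqP; rewrite mulf_eq0 orbb => /eqP.
  by rewrite /gramz /gram3 /= /m /z (zzC x k j) (zzC x l j) (zzC x l k); ring.
have xE : x3 a x k j l = (a`_j * x2 x l k + a`_k * x2 x l j + a`_l * x2 x k j
    - a`_l * a`_k * a`_j - s) / 2.
  by rewrite /s /s3 (x3_cyc a x j k l); field.
(* Formally minus the Gram determinant of X_l and the traceless part of M_k M_j. That part is a_k/2
   X_j + a_j/2 X_k plus half the commutator [X_k, X_j]; the last term has square -m j j k / 2 and is
   orthogonal to X_j, X_k and, as s = 0, to X_l. *)
suff -> : psi (x3 a x k j l) (x2 x k j) a`_l =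
    - ((a`_k / 2) ^+ 2 * m j j l + (a`_j / 2) ^+ 2 * m k k l
       + 2 * (a`_k / 2) * (a`_j / 2) * m j k l - m j j k * z l l / 2).
  by rewrite !m1 !mulr0 !mul0r !addr0 subr0 oppr0 mulr0.
rewrite xE s0 /m /z /zz !eqxx (negbTE jk) (negbTE jl) (negbTE kl).
by rewrite (x2C x k j) (x2C x l j) (x2C x l k) /psi; field.
Qed.

Lemma realizes_dotm x M i j : realizes a x M -> dotm (M i) (M j) = zz a x i j.
Proof.
case=> h1 h2 _; rewrite /zz; case: eqP => [->|/eqP ij].
  by rewrite dotm_det; case: (h1 j) => -> ->; rewrite mulr1.
by rewrite (h2 j) 1?eq_sym // /dotm; case: (h1 i) => _ ->; case: (h1 j) => _ ->.
Qed.

Lemma realizes_trip x M i j k : realizes a x M -> uniq [:: i; j; k] ->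
  trip (M i) (M j) (M k) = s3 a x i j k.
Proof.
case=> h1 h2 h3 u; rewrite /s3 h3 //.
move: u; rewrite /= !inE !negb_or andbT -!andbA => /and3P[ij ik jk].
rewrite !h2 // /trip; case: (h1 i) => _ ->; case: (h1 j) => _ ->.
by case: (h1 k) => _ ->.
Qed.

Lemma realizes_Sset x M : realizes a x M -> gword a x (enum 'I_n) = a`_n -> Sset a x.
Proof.
move=> rM gn; split=> [i1 i2 i3 j1 j2 j3 hi hj|_ i p0 p1 p2 p3|_]; last 1 first.
- by rewrite gn subrr.
- rewrite type1E -!(realizes_trip rM) ?uniq_lt // /gramz /gram3 /=.
  rewrite -!(realizes_dotm _ _ rM).
  exact: (trip_gram (M i1) (M i2) (M i3) (M j1) (M j2) (M j3)).
move=> /and3P[h01 h12 h23].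
rewrite /type2 -!(realizes_dotm _ _ rM) -!(realizes_trip rM) ?uniq_lt //; try lia.
exact: trip_dot.
Qed.

Lemma Sset_realizes x j k (i0 : option 'I_n) : (3 <= n)%N -> chart_index j k i0 ->
  Schart a j k i0 x -> exists M, realizes a x M.
Proof.
move=> n3 ci [Sx px]; have [jk hl] := chart_index_neq n3 ci.
have [al [be [p [r [q hd]]]]] := chart_nondegenerate jk hl Sx px.
have [M [hM1 hM2 hM3]] := gram_realization (fun i : 'I_n => a`_i) (zzC x)
  (fun i1 i2 i3 j1 j2 j3 => s3alt_type1 i1 i2 i3 j1 j2 j3 Sx) hd.
have hx2 i l : i != l -> x2 x l i = \tr (M l *m M i).
  move=> il; have := hM2 l i; rewrite /zz (negbTE (_ : l != i)) 1?eq_sym //.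
  rewrite /dotm !hM1.
  by move/addIr.
exists [ffun i => M i]; apply: realizes_lt => [i|i l il|i l m ilm]; rewrite !ffunE.
- split; last exact: hM1.
  (* As dotm A A = (tr A)^2/2 - 2 det A, the diagonal value z_ii forces determinant 1. *)
  have := dotm_det (M i); rewrite hM1 hM2 /zz eqxx => /addrI/oppr_inj.
  by rewrite -[X in X = _]mulr1 => /mulfI h; rewrite /SL2 /= h // pnatr_eq0.
- by apply: hx2; apply: contraTneq il => ->; rewrite ltnn.
have := hM3 i l m; have u := uniq_lt ilm; rewrite /s3alt u /trip !hM1 /s3.
move: u; rewrite /= !inE !negb_or andbT -!andbA => /and3P[nil nim nlm].
rewrite !hx2 // => /addrI /oppr_inj; rewrite /x3 ilm => /mulfI -> //.
by rewrite pnatr_eq0.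
Qed.
End AlgebraicSet.

(** * Irreducibility on the charts and uniqueness of normal forms *)

Section NormalForm.
Variables (R : realType) (n : nat) (a : n.+1.-tuple R[i]).
Implicit Types (x : trpoint R n) (i j k l : 'I_n) (M N : mtuple R n).

(** This is [psi] at the traces of D E, D, E for D = diag(lp, lm) and E of diagonal (e, h); if det E
    = 1, then e h - 1 is the product of the off-diagonal entries of E. *)
Lemma psi_diag (lp lm e h : R[i]) : lp * lm = 1 ->
  psi (lp * e + lm * h) (lp + lm) (e + h) = - (lp - lm) ^+ 2 * (e * h - 1).
Proof.
move=> hl; apply/eqP; rewrite -subr_eq0; apply/eqP.
apply: (@eq0_lincomb4 _ ((e + h) ^+ 2 - 4) 0 0 0 (1 - lp * lm) 0 0 0) => //.
  by rewrite hl subrr.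
by rewrite /psi; ring.
Qed.

Lemma x4E x M i j k l : realizes a x M -> uniq [:: k; j; i; l] ->
  x4 a x k j i l = \tr (M k *m M j *m M i *m M l).
Proof.
case=> h1 h2 h3 u; have tM p : \tr (M p) = a`_p by case: (h1 p).
move: u; rewrite /= !inE !negb_or !andbT -!andbA => /and5P[kj ki kl ji /andP[jl il]].
have {}h2 p q : p != q -> x2 x p q = \tr (M p *m M q) by rewrite eq_sym => /h2.
have {}h3 p q r : p != q -> p != r -> q != r ->
    x3 a x p q r = \tr (M p *m M q *m M r).
  move=> pq pr qr; apply: h3; rewrite /= !inE !negb_or.
  by rewrite (eq_sym r q) (eq_sym r p) (eq_sym q p) pq pr qr.
apply/esym; apply: mxtrace_mul4_eq (tM l) (tM i) (tM j) (tM k) (h2 k j kj)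
  (h2 k i ki)
  (h2 k l kl) (h2 j i ji) (h2 j l jl) (h2 i l il) (h3 k j i kj ki ji)
  (h3 k j l kj kl jl) (h3 k i l ki kl il) (h3 j i l ji jl il).
Qed.

Lemma realizes_conj x M N : realizes a x M -> conj_class M N -> realizes a x N.
Proof.
case=> h1 h2 h3 [P dP NE]; have Pu : P \in unitmx by rewrite unitmxE dP unitr1.
have c2 i j : N j *m N i = P *m (M j *m M i) *m invmx P.
  by rewrite !NE !mulmxA mulmxKV.
have ct A : \tr (P *m A *m invmx P) = \tr A.
  by rewrite mxtrace_mulC mulmxA mulVmx // mul1mx.
split=> [i|i j ij|i j k u].
- case: (h1 i) => di ti; rewrite NE; split; last by rewrite ct.
  by rewrite /SL2 /= !det_mulmx di mulr1 det_inv dP invr1 mulr1.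
- by rewrite h2 // c2 ct.
by rewrite h3 // c2 NE -ct !mulmxA mulmxKV.
Qed.

Lemma det_comm_psi (A B : 'M[R[i]]_2) : \det A = 1 -> \det B = 1 ->
  \det (A *m B - B *m A) = - psi (\tr (A *m B)) (\tr A) (\tr B).
Proof. by move=> dA dB; rewrite det_comm2 dA dB !mulr1. Qed.

(** The [psi] factor is minus the determinant of the commutator of M_k M_j with M_(i_0), or of M_k
    with M_j when i_0 = 0. *)
Lemma chart_comm x M j k (i0 : option 'I_n) : j != k ->
    (if i0 is Some l then (l != j) && (l != k) else true) = true ->
    realizes a x M -> pchart a j k i0 x <> 0 ->
  \det (M k *m M j *m M (odflt j i0) - M (odflt j i0) *m (M k *m M j)) != 0.
Proof.
move=> jk hl [h1 h2 h3] px; apply/eqP => d0; apply: px; rewrite /pchart.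
have dM i : \det (M i) = 1 by case: (h1 i).
have tM i : \tr (M i) = a`_i by case: (h1 i).
case: i0 hl d0 => [l /andP[lj lk]|_] d0.
  have u : uniq [:: l; j; k] by rewrite /= !inE !negb_or lj lk jk.
  have dD : \det (M k *m M j) = 1 by rewrite det_mulmx !dM mulr1.
  have := det_comm_psi dD (dM l); rewrite d0 => /esym/eqP; rewrite oppr_eq0 => /eqP.
  by rewrite -(h3 _ _ _ u) -(h2 _ _ jk) (tM l) => ->; rewrite mulr0.
have := det_comm_psi (dM k) (dM j); rewrite -(h2 _ _ jk) (tM k) (tM j).
(* [M_k M_j, M_j] = [M_k, M_j] M_j, so the two commutators have the same determinant. *)
move: d0; rewrite (mulmxA (M j)) -mulmxBl det_mulmx (dM j) mulr1 => ->.
by move/esym/eqP; rewrite oppr_eq0 => /eqP ->; rewrite mulr0.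
Qed.

(** A proper nonzero invariant subspace is a line, spanned by a common eigenvector in the kernel of
    the commutator of [chart_comm]. *)
Lemma chart_irreducible x M j k (i0 : option 'I_n) : j != k ->
    (if i0 is Some l then (l != j) && (l != k) else true) = true ->
    realizes a x M -> pchart a j k i0 x <> 0 -> irreducible_tuple M.
Proof.
move=> jk hl rM px U UM; have := chart_comm jk hl rM px.
set D := M k *m M j; set E := M _ => /= dn.
have [->|U0] := eqVneq U 0%VS; [by left | right].
apply/eqP; rewrite eqEdim subvf /= dimvf /dim /= muln1.
rewrite leqNgt; apply: contra dn => dU.
have dU1 : \dim U = 1%N.
  by apply/eqP; rewrite eqn_leq -ltnS dU lt0n dimv_eq0.
pose v := vpick U; have vU : v \in U := memv_pick U.
have v0 : v != 0 by rewrite vpick0.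
have Uv : U = <[v]>%VS.
  apply/esym/eqP; rewrite eqEdim -memvE vU dim_vline v0 dU1 //.
have [d dE] : exists d, D *m v = d *: v.
  by apply/vlineP; rewrite -Uv -mulmxA; apply/UM/UM.
have [e eE] : exists e, E *m v = e *: v by apply/vlineP; rewrite -Uv; apply: UM.
rewrite -det_tr; apply/det0P; exists v^T; first by rewrite trmx_eq0.
rewrite -trmx_mul mulmxBl -(mulmxA D) -(mulmxA E) dE eE -!scalemxAr dE eE.
rewrite !scalerA mulrC subrr.
by rewrite trmx0.
Qed.

(** [N k] is the diagonal matrix times the adjugate of [N j], and a_i, x_kji give the other
    diagonals. Two further traces give off-diagonal entries linearly: x_ki, x_ji if i_0 = 0; if i_0
    = l, then x_kl, x_jl for [N j] and x_il, x_kjil for the remaining [N i]. *)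
Lemma normal_form_unique x N j k (i0 : option 'I_n) (lp lm : R[i]) :
    j != k -> (if i0 is Some l then (l != j) && (l != k) else true) = true ->
    realizes a x N -> pchart a j k i0 x <> 0 -> lp * lm = 1 -> lp - lm != 0 ->
    N k *m N j = diag_mx (\row_p (if p == 0 then lp else lm)) ->
    N (odflt j i0) 1 0 = 1 ->
  normal_form a j k i0 x (lp - lm) = N.
Proof.
move=> jk hl rN px hl1 r0 ND NE; have [h1 h2 h3] := rN.
have dN i : N i 0 0 * N i 1 1 - N i 0 1 * N i 1 0 = 1 by rewrite -det2; case: (h1 i).
have tN i : a`_i = N i 0 0 + N i 1 1 by rewrite -mxtrace2; case: (h1 i).
have D00 : (N k *m N j) 0 0 = lp by rewrite ND !mxE mulr1n.
have D01 : (N k *m N j) 0 1 = 0 by rewrite ND !mxE mulr0n.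
have D10 : (N k *m N j) 1 0 = 0 by rewrite ND !mxE mulr0n.
have D11 : (N k *m N j) 1 1 = lm by rewrite ND !mxE mulr1n.
have dj : \det (N j) = 1 by case: (h1 j).
have [] := mulmx_adj2 dj erefl (A := N k).
rewrite D00 D01 D10 D11 !mul0r !subr0 !sub0r.
move=> k00 k01 k10 k11.
have xkj : x2 x k j = lp + lm by rewrite h2 // mxtrace2 D00 D11.
have aj := tN j; have ak := tN k; rewrite k00 k11 in ak.
have x3E i : i != j -> i != k -> x3 a x k j i = lp * N i 0 0 + lm * N i 1 1.
  move=> ij ik; have u : uniq [:: i; j; k] by rewrite /= !inE !negb_or ij ik jk.
  by rewrite h3 // mxtrace2 !(mulmx2E _ (N i)) D00 D01 D10 D11 !mul0r addr0 add0r.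
have x2jE i : i != j -> x2 x j i =
    N j 0 0 * N i 0 0 + N j 0 1 * N i 1 0 + (N j 1 0 * N i 0 1 + N j 1 1 * N i 1 1).
  by move=> ij; rewrite h2 // mxtrace2 !mulmx2E.
have x2kE i : i != k -> x2 x k i = lp * N j 1 1 * N i 0 0 - lp * N j 0 1 * N i 1 0
    - lm * N j 1 0 * N i 0 1 + lm * N j 0 0 * N i 1 1.
  by move=> ik; rewrite h2 // mxtrace2 !mulmx2E k00 k01 k10 k11; ring.
have lpE : (x2 x k j + (lp - lm)) / 2 = lp by rewrite xkj; field.
have lmE : (x2 x k j - (lp - lm)) / 2 = lm by rewrite xkj; field.
have kj : (k == j) = false by rewrite eq_sym (negbTE jk).
have div_rE u w : u = w * (lp - lm) -> u / (lp - lm) = w by move=> ->; rewrite mulfK.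
have k00' : - ((a`_j - lp * a`_k) / (lp - lm)) = N k 0 0.
  rewrite -mulNr; apply: div_rE; rewrite k00 aj ak.
  apply/eqP; rewrite -subr_eq0; apply/eqP.
  apply: (@eq0_lincomb4 _ (- N j 0 0 - N j 1 1) 0 0 0 (1 - lp * lm) 0 0 0) => //.
    by rewrite hl1 subrr.
  ring.
have p2 u11 u12 u21 u22 i : u11 = N i 0 0 -> u12 = N i 0 1 -> u21 = N i 1 0 ->
    u22 = N i 1 1 -> mx2 u11 u12 u21 u22 = N i.
  by move=> e1 e2 e3 e4; apply: mx2_eq; rewrite !mx2E.
have j00 : - ((a`_k - lp * a`_j) / (lp - lm)) = N j 0 0.
  by rewrite -mulNr; apply: div_rE; rewrite aj ak; ring.
have j11 : (a`_k - lm * a`_j) / (lp - lm) = N j 1 1.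
  by apply: div_rE; rewrite aj ak; ring.
have k11' : (a`_j - lm * a`_k) / (lp - lm) = N k 1 1.
  apply: div_rE; rewrite k11 aj ak.
  apply/eqP; rewrite -subr_eq0; apply/eqP.
  apply: (@eq0_lincomb4 _ (N j 0 0 + N j 1 1) 0 0 0 (1 - lp * lm) 0 0 0) => //.
    by rewrite hl1 subrr.
  ring.
have i00 i : i != j -> i != k -> (x3 a x k j i - lm * a`_i) / (lp - lm) = N i 0 0.
  by move=> ij ik; apply: div_rE; rewrite x3E // tN; ring.
have i11 i : i != j -> i != k ->
    - ((x3 a x k j i - lp * a`_i) / (lp - lm)) = N i 1 1.
  by move=> ij ik; rewrite -mulNr; apply: div_rE; rewrite x3E // tN; ring.
apply/ffunP => i; rewrite ffunE lpE lmE.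
case: i0 hl NE px => [l /andP[lj lk]|_] /= NE px.
  (* The lower left entry being 1, the factor e h - 1 of [psi_diag] is the upper right entry; the
     chart condition makes it nonzero, as the denominators require. *)
  have psiE : psi (x3 a x k j l) (x2 x k j) a`_l = - (lp - lm) ^+ 2 * N l 0 1.
    rewrite x3E // xkj tN psi_diag //; congr (_ * _).
    by rewrite -(dN l) NE; ring.
  have f0 : N l 0 1 != 0.
    apply/eqP => f0; apply: px; rewrite /pchart.
    by rewrite psiE f0 !mulr0.
  rewrite psiE (negbTE lj) (negbTE lk) (i00 l) // (i11 l) //.
  have j01 : - ((x2 x k l - a`_k * N l 0 0
               + lm * (x2 x j l - a`_j * N l 1 1)) / (lp - lm)) = N j 0 1.
    by rewrite -mulNr; apply: div_rE; rewrite x2kE // x2jE // ak aj NE; ring.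
  have j10 : - ((lp - lm) * (x2 x k l - a`_k * N l 1 1
       + lp * (x2 x j l - a`_j * N l 0 0)) / (- (lp - lm) ^+ 2 * N l 0 1)) = N j 1 0.
    rewrite x2kE // x2jE // ak aj NE.
    by field; rewrite f0 r0.
  have [->|ij] := eqVneq i j; first exact: p2.
  have [->|ik] := eqVneq i k.
    by apply: p2 => //=; rewrite ?j01 ?j10 ?k01 ?k10.
  have [->|il] := eqVneq i l.
    apply: p2 => //=; rewrite ?i00 ?i11 //.
    by field.
  have x4i : x4 a x k j i l = lp * (N i 0 0 * N l 0 0 + N i 0 1)
      + lm * (N i 1 0 * N l 0 1 + N i 1 1 * N l 1 1).
    rewrite (x4E rN); last first.
      rewrite /= !inE !negb_or (eq_sym k j) (eq_sym k i) (eq_sym k l) (eq_sym j i).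
      by rewrite (eq_sym j l) jk ik lk ij lj il.
    rewrite -mulmxA mxtrace2 !(mulmx2E _ (N i *m N l)) D00 D01 D10 D11 !mulmx2E NE.
    by ring.
  have x2i : x2 x i l = N i 0 0 * N l 0 0 + N i 0 1
      + (N i 1 0 * N l 0 1 + N i 1 1 * N l 1 1).
    by rewrite h2 1?eq_sym // mxtrace2 !mulmx2E NE mulr1.
  rewrite (i00 i) // (i11 i) //; apply: p2 => //=; rewrite x4i x2i.
    by rewrite -mulNr; apply: div_rE; ring.
  by field; rewrite f0 r0.
have psiE : psi (x2 x k j) a`_k a`_j = - (lp - lm) ^+ 2 * N j 0 1.
  (* Here [N k] is D times the inverse of [N j], so [psi_diag] is applied to that inverse, whose
     diagonal is that of [N j] swapped. *)
  have := psi_diag (N j 1 1) (N j 0 0) hl1.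
  rewrite -ak [N j 1 1 + _]addrC -aj -xkj => h.
  transitivity (psi a`_k (x2 x k j) a`_j); first by rewrite /psi; ring.
  by rewrite h; congr (_ * _); rewrite -(dN j) NE; ring.
have f0 : N j 0 1 != 0.
  by apply/eqP => f0; apply: px; rewrite /pchart psiE f0 !mulr0.
rewrite psiE; have q01 : - (- (lp - lm) ^+ 2 * N j 0 1 / (lp - lm) ^+ 2) = N j 0 1.
  by field.
rewrite q01.
have [->|ij] := eqVneq i j; first exact: p2.
have [->|ik] := eqVneq i k.
  by apply: p2 => //=; rewrite ?k01 ?k10 ?NE.
rewrite (i00 i) // (i11 i) // x2kE // x2jE // ak aj NE; apply: p2 => //=.
  by apply: div_rE; ring.
by field; rewrite f0 r0.
Qed.
End NormalForm.

(** * Fibers of the trace map and patching of the charts *)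

Section Fibers.
Variables (R : realType) (n : nat) (a : n.+1.-tuple R[i]).
Implicit Types (x : trpoint R n) (j k : 'I_n) (M N : mtuple R n).

Lemma conj_class_sym M N : conj_class M N -> conj_class N M.
Proof.
case=> P dP NE; have Pu : P \in unitmx by rewrite unitmxE dP unitr1.
exists (invmx P); first by rewrite /SL2 /= det_inv dP invr1.
by move=> i; rewrite NE invmxK !mulmxA mulVmx // mul1mx mulmxKV.
Qed.

Lemma conj_class_trans M N L : conj_class M N -> conj_class N L -> conj_class M L.
Proof.
case=> P dP NE [Q dQ LE]; have Pu : P \in unitmx by rewrite unitmxE dP unitr1.
have Qu : Q \in unitmx by rewrite unitmxE dQ unitr1.
exists (Q *m P); first by rewrite /SL2 /= det_mulmx dQ dP mulr1.
by move=> i; rewrite LE NE -[invmx (Q *m P)]/((Q * P)^-1) invrM // !mulmxA.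
Qed.

Lemma conj_class_eq M N : conj_class M N -> conj_class N = conj_class M.
Proof.
move=> MN; apply/seteqP; split=> L; first exact: conj_class_trans.
exact: conj_class_trans (conj_class_sym MN).
Qed.

Lemma traces_Sset M : (3 <= n)%N -> reps a M -> Sset a (traces M).
Proof.
move=> n3 rM; have rz := realizes_traces n3 rM; apply: realizes_Sset (rz) _.
have [hM [_ <-]] := rM; rewrite MlastE invmx2_tr.
  by apply: gword_tr rz _ _; [apply: sorted_enum_ord
    | rewrite -size_eq0 size_enum_ord -lt0n; apply: leq_trans n3].
elim: (rev _) => [|i s IH]; first by rewrite big_nil det1.
by rewrite big_cons -mulmxE det_mulmx IH mulr1; case: (hM i).
Qed.

(** Defined without a chart; at the points of a chart it is a single class by [fiber_class]. *)
Definition fiber x : set (mtuple R n) := [set M | reps a M /\ traces M = x].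

(** [simul_normalize] moves [M] to a tuple that [normal_form_unique] identifies. As [r] is any
    square root, the class of the normal form does not depend on it. *)
Lemma normal_form_conj x M j k (i0 : option 'I_n) (r : R[i]) :
    (3 <= n)%N -> chart_index j k i0 -> Schart a j k i0 x ->
    r ^+ 2 = x2 x k j ^+ 2 - 4 ->
    realizes a x M ->
  conj_class M (normal_form a j k i0 x r).
Proof.
move=> n3 ci [Sx px] hr rM; have [jk hl] := chart_index_neq n3 ci.
pose lp := (x2 x k j + r) / 2; pose lm := (x2 x k j - r) / 2.
have rE : lp - lm = r by rewrite /lp /lm; field.
have r0 : lp - lm != 0.
  apply/eqP => r0; apply: px; rewrite /pchart -hr -rE r0.
  by rewrite expr2 !mul0r.
have lE : lp * lm = 1.
  have -> : lp * lm = (x2 x k j ^+ 2 - r ^+ 2) / 4 by rewrite /lp /lm; field.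
  by rewrite hr opprB addrC subrK divff // pnatr_eq0.
have [h1 h2 _] := rM.
have [||||P dP [PD PE]] := @simul_normalize _ (M k *m M j) (M (odflt j i0)) lp lm.
- by rewrite -subr_eq0.
- by rewrite -h2 // /lp /lm; field.
- by rewrite lE det_mulmx; case: (h1 k) => -> _; case: (h1 j) => -> _; rewrite mulr1.
- exact: chart_comm rM px.
have Pu : P \in unitmx by rewrite unitmxE dP unitr1.
pose N : mtuple R n := [ffun i => P *m M i *m invmx P].
have MN : conj_class M N by exists P => // i; rewrite ffunE.
rewrite -rE (@normal_form_unique _ _ _ x N) //.
- exact: realizes_conj MN.
- by rewrite !ffunE -PD !mulmxA mulmxKV.
- by rewrite ffunE.
Qed.

Lemma phi_chart_fiber j k (i0 : option 'I_n) (r : trpoint R n -> R[i]) x :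
    (3 <= n)%N -> chart_index j k i0 -> sqrt_choice a j k i0 r ->
    Schart a j k i0 x ->
  phi_chart a j k i0 r x = fiber x.
Proof.
move=> n3 ci hr Sx; have [Sx' px] := Sx; rewrite /phi_chart.
have hc M : realizes a x M ->
    conj_class (normal_form a j k i0 x (r x)) = conj_class M.
  by move=> rM; apply: conj_class_eq; apply: normal_form_conj n3 ci Sx (hr _ Sx) rM.
(* The normal form is known to have trace coordinates [x] only through its conjugacy to a realizing
   tuple. *)
have [M rM] := Sset_realizes n3 ci Sx; apply/seteqP; split=> N.
  rewrite (hc _ rM) => /(realizes_conj rM) rN.
  exact: traces_realizes n3 rN (gword_Sset n3 Sx').
case=> rN tN; rewrite (hc N); first exact: conj_class_refl.
by rewrite -tN; apply: realizes_traces.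
Qed.

Lemma fiber_class x j k (i0 : option 'I_n) M :
    (3 <= n)%N -> chart_index j k i0 -> Schart a j k i0 x ->
  fiber x M -> fiber x = conj_class M /\ irreducible_tuple M.
Proof.
move=> n3 ci Sx [rM tM].
have rz : realizes a x M by rewrite -tM; apply: realizes_traces.
have [jk hl] := chart_index_neq n3 ci; split; last first.
  by case: Sx => _; apply: chart_irreducible jk hl rz.
pose r (y : trpoint R n) := sqrtC (x2 y k j ^+ 2 - 4).
have hr : sqrt_choice a j k i0 r by move=> y _; rewrite sqrtCK.
rewrite -(phi_chart_fiber n3 ci hr Sx); apply: conj_class_eq.
exact: normal_form_conj n3 ci Sx (hr _ Sx) rz.
Qed.

(** On a chart [fiber] and [Phi] are mutually inverse; this gives one composite and [Mchart_fiber]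
    the other. *)
Lemma fiber_Mchart x j k (i0 : option 'I_n) :
    (3 <= n)%N -> chart_index j k i0 ->
  Schart a j k i0 x -> Mchart a j k i0 (fiber x) /\ Phi (fiber x) = x.
Proof.
move=> n3 ci Sx; have [Sx' px] := Sx; have [M rM] := Sset_realizes n3 ci Sx.
have fM : fiber x M by apply: traces_realizes n3 rM (gword_Sset n3 Sx').
have [-> irrM] := fiber_class n3 ci Sx fM; rewrite /Mchart /= Phi_class.
have [repM tM] := fM; rewrite tM; split=> //; split=> //.
by exists M.
Qed.

Lemma Mchart_fiber c j k (i0 : option 'I_n) :
    (3 <= n)%N -> chart_index j k i0 ->
  Mchart a j k i0 c -> Schart a j k i0 (Phi c) /\ c = fiber (Phi c).
Proof.
move=> n3 ci [[M [rM _] <-]]; rewrite Phi_class => px.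
have Sx : Schart a j k i0 (traces M) by split=> //; apply: traces_Sset n3 rM.
by split=> //; have [] := fiber_class n3 ci Sx (conj rM erefl).
Qed.

Lemma fiber_bij_chart j k (i0 : option 'I_n) :
    (3 <= n)%N -> chart_index j k i0 ->
  set_bij (Schart a j k i0) (Mchart a j k i0) fiber.
Proof.
move=> n3 ci; split=> [x Sx|x y /set_mem Sx /set_mem Sy xy|c Mc].
- by have [] := fiber_Mchart n3 ci Sx.
- have [_ <-] := fiber_Mchart n3 ci Sx; have [_ <-] := fiber_Mchart n3 ci Sy.
  by rewrite xy.
by have [Sx cE] := Mchart_fiber n3 ci Mc; exists (Phi c).
Qed.

End Fibers.

Theorem theorem4p1 (R : realType) (n : nat) (hn : (3 <= n)%N)
    (a : n.+1.-tuple (complex R)) :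
  (forall (j k : 'I_n) (i0 : option 'I_n) (r : trpoint R n -> complex R),
     chart_index j k i0 -> sqrt_choice a j k i0 r ->
     set_bij (Schart a j k i0) (Mchart a j k i0) (phi_chart a j k i0 r))
  /\ (forall (j k j' k' : 'I_n) (i0 i0' : option 'I_n)
             (r r' : trpoint R n -> complex R),
     chart_index j k i0 -> sqrt_choice a j k i0 r ->
     chart_index j' k' i0' -> sqrt_choice a j' k' i0' r' ->
     forall x, Schart a j k i0 x -> Schart a j' k' i0' x ->
       phi_chart a j k i0 r x = phi_chart a j' k' i0' r' x)
  /\ (exists phi : trpoint R n -> set (mtuple R n),
     set_bij (Sopen a) (Mopen a) phi
     /\ forall (j k : 'I_n) (i0 : option 'I_n) (r : trpoint R n -> complex R),
          chart_index j k i0 -> sqrt_choice a j k i0 r ->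
          forall x, Schart a j k i0 x -> phi x = phi_chart a j k i0 r x).
Proof.
split.
  move=> j k i0 r ci hr; have phiE := phi_chart_fiber hn ci hr.
  have [h1 h2 h3] := fiber_bij_chart a hn ci.
  split=> [x Sx|x y Sx Sy|c /h3 [x Sx <-]].
  - by rewrite phiE //; apply: h1.
  - by rewrite !phiE; [apply: h2 | exact: set_mem | exact: set_mem].
  by exists x; rewrite ?phiE.
split.
  move=> j k j' k' i0 i0' r r' ci hr ci' hr' x Sx Sx'.
  by rewrite (phi_chart_fiber hn ci hr Sx) (phi_chart_fiber hn ci' hr' Sx').
exists (fiber a); split; last first.
  by move=> j k i0 r ci hr x Sx; rewrite (phi_chart_fiber hn ci hr Sx).
split=> [x [j [k [i0 [ci Sx]]]]|x y|c [j [k [i0 [ci Mc]]]]].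
- by exists j, k, i0; split=> //; have [] := fiber_Mchart hn ci Sx.
(* The two points may come from different charts; [Phi] recovers each from its fiber, whatever the
   chart. *)
- move=> /set_mem[j [k [i0 [ci Sx]]]] /set_mem[j' [k' [i0' [ci' Sy]]]] xy.
  have [_ <-] := fiber_Mchart hn ci Sx; have [_ <-] := fiber_Mchart hn ci' Sy.
  by rewrite xy.
have [Sx cE] := Mchart_fiber hn ci Mc; exists (Phi c) => //.
by exists j, k, i0.
Qed.
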